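(* Let $b\in\mathbb{R}$ be a constant and let $g:[0,\infty)\to[0,1]$ be a non-increasing function with $0<C:=\int_{\mathbb{R}^2}g(\|\boldsymbol{x}\|)\,d\boldsymbol{x}<\infty$ and $g(x)=o\left(\frac{1}{x^2\log^2 x}\right)$ as $x\to\infty$. Put $r_\rho=\sqrt{\frac{\log\rho+b}{C\rho}}$. Let $W^{E}=W^{E}(\rho)$ be the number of isolated nodes in the random connection network $\mathcal{G}(\mathcal{X}_\rho,g_\rho)$ on the unit square that are due to the boundary effect (as defined in the context). Then $W^E$ is asymptotically almost surely $0$, i.e. $\lim_{\rho\to\infty}\Pr\left(W^{E}=0\right)=1$.
   Context: Nodes form a homogeneous Poisson point process $\mathcal{X}_\rho$ of density $\rho$ on $A=\left[-\frac12,\frac12\right)^2$. $\|\cdot\|$ is the Euclidean norm and the toroidal distance is $\|\boldsymbol{x}_1-\boldsymbol{x}_2\|^{T}=\min\{\|\boldsymbol{x}_1+\boldsymbol{z}-\boldsymbol{x}_2\|:\boldsymbol{z}\in\mathbb{Z}^2\}$, so $\|\boldsymbol{x}_1-\boldsymbol{x}_2\|^{T}\le\|\boldsymbol{x}_1-\boldsymbol{x}_2\|$. In the torus network $\mathcal{G}^{T}(\mathcal{X}_\rho,g_\rho)$, given the node positions, each pair of nodes at toroidal distance $x^{T}$ is directly connected with probability $g(x^{T}/r_\rho)$, independently of all other pairs. In the square network $\mathcal{G}(\mathcal{X}_\rho,g_\rho)$, each pair of nodes at Euclidean distance $x$ is directly connected with probability $g(x/r_\rho)$, independently of all other pairs.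 A node is isolated if it is not directly connected to any other node. Coupling and definition of $W^E$: start from an instance of $\mathcal{G}^{T}(\mathcal{X}_\rho,g_\rho)$ and remove each of its connections, independently of all others, with probability $1-\frac{g(x/r_\rho)}{g(x^{T}/r_\rho)}$, where $x$ and $x^{T}$ are the Euclidean and the toroidal distance between the endpoints of that connection. The resulting network has the law of $\mathcal{G}(\mathcal{X}_\rho,g_\rho)$. $W^{E}$ is the number of newly appeared isolated nodes, i.e. nodes that are isolated after the removal but were not isolated before it; it is called the number of isolated nodes due to the boundary effect. Throughout, $\rho$ is large enough that $\log\rho+b>0$. *)

(* Defs.v *)
From HB Require Import structures.
From mathcomp Require Import all_boot all_order all_algebra.
From mathcomp Require Import all_classical all_reals all_analysis.

Set Implicit Arguments.
Unset Strict Implicit.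
Unset Printing Implicit Defensive.

Import Order.TTheory GRing.Theory Num.Theory.
Import numFieldNormedType.Exports.

Local Open Scope classical_set_scope.
Local Open Scope ring_scope.

Section geometry.
Context {R : realType}.
Implicit Types x y : R * R.

Definition unit_square : set (R * R) :=
  [set x | (- 2^-1 <= x.1 < 2^-1) /\ (- 2^-1 <= x.2 < 2^-1)].

(* The library norm of R * R is the sup norm, hence the explicit formula. *)
Definition enorm x : R := Num.sqrt (x.1 ^+ 2 + x.2 ^+ 2).

Definition edist x y : R := enorm (x - y).

(* The infimum is a minimum, Z^2 being discrete and closed. *)
Definition tdist x y : R :=
  inf [set enorm (x + (z.1%:~R, z.2%:~R) - y) | z in [set: int * int]].

Definition area : set (R * R) -> \bar R :=
  (lebesgue_measure \x lebesgue_measure)%E.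

End geometry.

(* A finite point process is a random finite sequence; the order in which the
   points are listed is arbitrary, and only the counts below constrain it. *)
Section point_process.
Context {R : realType} {d : measure_display} {T : measurableType d}.
Implicit Types (pts : T -> seq (R * R)) (B : set (R * R)).

Definition node pts (i : nat) (w : T) : R * R := nth 0 (pts w) i.

Definition node_in pts i B : set T :=
  [set w | (i < size (pts w))%N /\ B (node pts i w)].

Definition npoints pts B (w : T) : nat := count (mem B) (pts w).

Record poisson_process (P : probability T R) (A : set (R * R)) (rho : R) pts :
    Prop := PoissonProcess {
  pp_sub : forall w x, x \in pts w -> A x ;
  pp_meas : forall i B, measurable B -> measurable (node_in pts i B) ;
  (* poisson_prob has an unused nat argument, instantiated here with k *)
  pp_poisson : forall B (k : nat), measurable B -> B `<=` A ->
    P [set w | npoints pts B w = k] =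
    poisson_prob (rho * fine (area B)) k [set k] ;
  pp_indep : forall (m : nat) (B : 'I_m -> set (R * R)) (K : 'I_m -> set nat),
    (forall i, measurable (B i) /\ B i `<=` A) -> trivIset setT B ->
    P (\bigcap_i [set w | K i (npoints pts (B i) w)]) =
    (\prod_i P [set w | K i (npoints pts (B i) w)])%E }.

(* Generators of the sigma-algebra of the node positions; taking B := setT
   yields the events [i < size (pts w)], i.e. the number of nodes. *)
Definition position_events pts : set (set T) :=
  [set D | exists i B, measurable B /\ D = node_in pts i B].

End point_process.

(* Given the sigma-algebra G, the trial i takes place on the event S i of G;
   the trials that take place succeed independently, the i-th one with
   conditional probability p i.  E i is the event that trial i takes place and
   succeeds. *)
Record cond_indep_trials {R : realType} {d : measure_display}
    {T : measurableType d} {I : eqType} (P : probability T R)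
    (G : set (set T)) (S E : I -> set T) (p : I -> T -> R) : Prop :=
  CondIndepTrials {
  cit_meas : forall i, measurable (E i) ;
  cit_prod : forall (J : seq I) (D : set T), uniq J -> G D ->
    (forall i, i \in J -> D `<=` S i) ->
    P (D `&` [set w | forall i, i \in J -> E i w]) =
    (\int[P]_(w in D) (\prod_(i <- J) p i w)%:E)%E }.

(* An undirected network on the vertices 0, ..., n.-1 is given by the values
   e i j for i < j < n; all the other values of e are irrelevant. *)
Definition linked (e : rel nat) (i j : nat) : bool :=
  (i != j) && e (minn i j) (maxn i j).

Definition isolated (n : nat) (e : rel nat) (i : 'I_n) : bool :=
  [forall j : 'I_n, ~~ linked e i j].

Section coupling.
Context {R : realType} {d : measure_display} {T : measurableType d}.
Variables (P : probability T R) (g : R -> R) (r rho : R).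
(* node positions; connections of the torus network; removed connections *)
Variables (pts : T -> seq (R * R)) (conn removed : T -> rel nat).

Definition pair_event (ij : nat * nat) : set T :=
  [set w | (ij.1 < ij.2 < size (pts w))%N].

Definition conn_event (ij : nat * nat) : set T :=
  pair_event ij `&` [set w | conn w ij.1 ij.2].

Definition removal_event (ij : nat * nat) : set T :=
  conn_event ij `&` [set w | removed w ij.1 ij.2].

Definition torus_prob (ij : nat * nat) (w : T) : R :=
  g (tdist (node pts ij.1 w) (node pts ij.2 w) / r).

Definition square_prob (ij : nat * nat) (w : T) : R :=
  g (edist (node pts ij.1 w) (node pts ij.2 w) / r).

(* conn and removed are constrained only through the pairs i < j of existing
   nodes, and removed only on the connected ones.  0 / 0 = 0 is harmless: a pair with torus_prob 0 is almost surely not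
   connected, so that its removal is not considered. *)
Record boundary_coupling : Prop := BoundaryCoupling {
  bc_nodes : poisson_process P unit_square rho pts ;
  bc_torus : cond_indep_trials P <<s position_events pts >>
    pair_event conn_event torus_prob ;
  bc_removal : cond_indep_trials P
    <<s position_events pts `|` range conn_event >>
    conn_event removal_event
    (fun ij w => 1 - square_prob ij w / torus_prob ij w) }.

(* Its restriction to the existing nodes is the square network. *)
Definition kept (w : T) : rel nat := fun i j => conn w i j && ~~ removed w i j.

Definition WE (w : T) : nat :=
  #|[set i : 'I_(size (pts w)) |
      isolated (kept w) i && ~~ isolated (conn w) i]|.

End coupling.

Definition critical_radius {R : realType} (b C rho : R) : R :=
  Num.sqrt ((ln rho + b) / (C * rho)).

(* Main.v *)
(* Cut the square into N x N cells, N large, and call two cells near if they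
   differ by at most m in both coordinates; nodes in near cells have equal
   Euclidean and torus distances, so almost surely no connection between them
   is removed.  A newly isolated node is thus not connected to the nodes in near
   cells on the torus, and either its cell lies within m cells of the boundary
   or it is connected to a node in a far cell.  The cell counts are independent
   Poisson variables of mean lam = rho / N^2, hence, by Markov's inequality,
     Pr (W^E <> 0) <= sum_c lam * exp (- lam * sum_c' v c c')
                              * ([c boundary] + lam * sum_c' u c c'),
   where v <= g <= u are bounds of the connection probability on the near,
   resp. far, cells.  For m/N ~ r_rho * exp (theta * L), with
   L = log rho + b, comparing sums with the integral C gives
   lam * sum v ~ L at an interior cell, at least L/2 - O(1) at an edge and
   L/4 - O(1) at a corner; the tail of g outside the near cells is small by the
   o(1 / (x^2 log^2 x)) assumption because log (exp (theta * L)) is of order L.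
   The corners contribute O(exp ((2 theta - 1/4) L) L), and
   the edges O(L^(-1/2)) because the nodes away from the very edge have a
   strictly larger expected degree. *)
Require Import Defs.
From mathcomp Require Import all_boot all_order all_algebra.
From mathcomp Require Import all_classical all_reals all_analysis.
From mathcomp Require Import measurable_realfun.
From mathcomp Require Import ring lra zify.
Import Order.TTheory GRing.Theory Num.Theory.
Import numFieldNormedType.Exports.
Local Open Scope classical_set_scope.
Local Open Scope ring_scope.
Set Implicit Arguments.
Unset Strict Implicit.
Unset Printing Implicit Defensive.

(** * Independent counts *)

(** The process is constrained only through counts on disjoint sets, so sums over nodes cannot be
    averaged directly. Conditioning on the sequence of cells of the nodes replaces this: the bounds
    on the connection probabilities become constants, the union bound over nodes becomes an
    expression in the counts, and its expectation factorizes. The price is a discretization error of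
    order [m] cells per node, absorbed by [N >= 4 * rho].

    The near radius [r_rho * exp (theta * L)] is a compromise. An interior node is isolated on the
    torus with probability about [exp (- L)], and [rho * exp (- L) = exp (- b)] does not vanish; the
    expected number of its far connections must therefore be small, which requires a radius whose
    logarithm is of order [L]. On the other hand about [L * exp (2 * theta * L)] nodes lie at the
    corners, and [theta <= 1 / 16] keeps them negligible against [exp (L / 4)]. The edges consist of
    about [s * exp (theta * L)] rows, [s] being the number of cells per radius; the second bound on
    [theta], in terms of a square on which [g] is bounded below, lets the excess degree away from
    the side outweigh the factor [exp (theta * L)]. *)

Section counts.
Context {R : realType} {d : measure_display} {T : measurableType d}.
Variable P : probability T R.

Lemma countable_valued_measurable (N : T -> nat) :
  (forall k, measurable [set w | N w = k]) -> measurable_fun setT N.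
Proof.
move=> mN _ Y _; rewrite setTI.
have -> : N @^-1` Y = \bigcup_(k in Y) [set w | N w = k].
  by apply/seteqP; split => [w Yw|w [k Yk] /= ->] //; exists (N w).
by apply: bigcup_measurable.
Qed.

Lemma sum_fibers (N : T -> nat) (A : set T) :
  (forall k, measurable [set w | N w = k]) -> measurable A ->
  P A = (\sum_(k <oo) P (A `&` [set w | N w = k]))%E.
Proof.
move=> mN mA.
have {1}-> : A = \bigcup_k (A `&` [set w | N w = k]).
  apply/seteqP; split => [w Aw|w [k _ []]] //.
  by exists (N w).
apply: measure_semi_bigcup => //.
- by move=> k; apply: measurableI.
- by move=> i j _ _ [w [[_ <-] [_ <-]]].
- by apply: bigcup_measurable => k _; apply: measurableI.
Qed.

Lemma integral_fibers (N : T -> nat) (f : nat -> R) (X : T -> \bar R) :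
  (forall k, measurable [set w | N w = k]) -> (forall k, 0 <= f k) ->
  measurable_fun setT X -> (forall w, 0 <= X w)%E ->
  (\int[P]_w ((f (N w))%:E * X w) =
   \sum_(k <oo) (f k)%:E * \int[P]_w ((\1_[set w | N w = k] w)%:E * X w))%E.
Proof.
move=> mN f0 mX X0.
have mI k : measurable_fun setT (fun w => (\1_[set w | N w = k] w : R)%:E).
  by apply/measurable_EFinP; apply: measurable_indic.
have mIX k : measurable_fun setT
    (fun w => (\1_[set w | N w = k] w : R)%:E * X w)%E.
  by apply: emeasurable_funM.
have IX0 k w : (0 <= (\1_[set w | N w = k] w : R)%:E * X w)%E.
  by apply: mule_ge0 => //; rewrite lee_fin.
transitivity (\int[P]_w (\sum_(k <oo)
    ((f k)%:E * ((\1_[set w | N w = k] w)%:E * X w))))%E.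
  apply: eq_integral => w _.
  rewrite (@nneseriesD1 _ _ (N w))//; last first.
    by move=> k _; apply: mule_ge0; rewrite ?lee_fin.
  rewrite indicE mem_set //= mul1e eseries0 ?adde0// => k _ kN.
  rewrite indicE memNset ?mul0e ?mule0// => Nk.
  by rewrite /= in Nk; move: kN; rewrite Nk eqxx.
rewrite integral_nneseries //.
- apply: eq_eseriesr => k _; rewrite ge0_integralZl//.
  by rewrite lee_fin.
- by move=> k; apply: measurable_funeM.
- by move=> k w _; apply: mule_ge0; rewrite ?lee_fin.
Qed.

(* Independence is assumed for events only; each factor in turn is expanded
   over the values of its count. *)
Lemma expectation_prod_indep (m : nat) (N : 'I_m -> T -> nat) :
  (forall i k, measurable [set w | N i w = k]) ->
  (forall K : 'I_m -> set nat, P (\bigcap_i [set w | K i (N i w)]) =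
    (\prod_i P [set w | K i (N i w)])%E) ->
  forall f : 'I_m -> nat -> R, (forall i k, 0 <= f i k) ->
  (\int[P]_w (\prod_i f i (N i w))%:E =
   \prod_i \int[P]_w (f i (N i w))%:E)%E.
Proof.
move=> mN indep.
pose ind (K : set nat) k : R := \1_K k.
have mfN (f : nat -> R) i : measurable_fun setT (fun w => f (N i w)).
  by apply: (@measurableT_comp _ _ _ _ _ _ f) => //;
    exact: countable_valued_measurable.
have mprod (f : 'I_m -> nat -> R) (Q : pred 'I_m) :
    measurable_fun setT (fun w => (\prod_(i | Q i) f i (N i w))%:E).
  apply/measurable_EFinP; under eq_fun do rewrite -big_filter.
  by apply: measurable_prod => i _; exact: mfN.
(* Induction on the number [n] of leading factors that are arbitrary, all others being indicators.
   For [n = 0] this is the assumed independence of events. *)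
suff claim : forall (n : nat) (f : 'I_m -> nat -> R), (n <= m)%N -> (forall i k, 0 <= f i k) ->
    (forall i : 'I_m, (n <= i)%N -> exists K, f i = ind K) ->
    (\int[P]_w (\prod_i f i (N i w))%:E =
     \prod_i \int[P]_w (f i (N i w))%:E)%E.
  move=> f f0; apply: (claim m) => // i.
  by rewrite leqNgt ltn_ord.
elim=> [|n IH] f nm f0 fK.
  have {fK} /choice[K fK] : forall i, exists K, f i = ind K.
    by move=> i; exact: fK.
  have pre i : [set w | K i (N i w)] = N i @^-1` (K i) by [].
  have mK i : measurable [set w | K i (N i w)].
    by rewrite pre -[X in measurable X]setTI;
      apply: countable_valued_measurable.
  transitivity (P (\bigcap_i [set w | K i (N i w)])).
    rewrite -(setIT (\bigcap_i _)) -integral_indic//; last first.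
      apply: fin_bigcap_measurable => //; exact: finite_finset.
    apply: eq_integral => w _; congr EFin.
    rewrite indicE.
    have [inK|notK] := pselect ((\bigcap_i [set w | K i (N i w)]) w).
      rewrite big1 ?mem_set// => i _; rewrite fK /ind indicE mem_set//.
      exact: inK.
    have [i niK] : exists i, ~ K i (N i w).
      by apply/existsNP => inK; apply: notK => i _; exact: inK.
    rewrite memNset// (bigD1 i)//= fK /ind indicE.
    by rewrite memNset// mul0r.
  rewrite indep; apply: eq_bigr => i _.
  rewrite -(setIT [set w | _]) -integral_indic//.
  by apply: eq_integral => w _; rewrite fK /ind /= !indicE.
pose i0 := Ordinal nm.
have integ (f' : 'I_m -> nat -> R) : (forall i k, 0 <= f' i k) ->
    (\int[P]_w (\prod_i f' i (N i w))%:E =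
     \sum_(k <oo) (f' i0 k)%:E * \int[P]_w ((\1_[set w | N i0 w = k] w)%:E *
       (\prod_(i | i != i0) f' i (N i w))%:E))%E.
  move=> f'0.
  rewrite -integral_fibers//.
  - apply: eq_integral => w _.
    by rewrite (bigD1 i0)//= EFinM.
  - by move=> w; rewrite lee_fin prodr_ge0.
rewrite integ//.
have step k : (\int[P]_w ((\1_[set w | N i0 w = k] w)%:E *
       (\prod_(i | i != i0) f i (N i w))%:E) =
     \int[P]_w (\1_[set w | N i0 w = k] w)%:E *
     \prod_(i | i != i0) \int[P]_w (f i (N i w))%:E)%E.
  (* Fixing the value [k] of the count [i0] turns its factor into an indicator, so that one
     arbitrary factor fewer remains. *)
  pose fk (i : 'I_m) := if i == i0 then ind [set k] else f i.
  have fk0 i j : 0 <= fk i j.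
    by rewrite /fk; case: ifP => // _; rewrite /ind indicE.
  have fkK (i : 'I_m) : (n <= i)%N -> exists K, fk i = ind K.
    rewrite leq_eqVlt /fk; case: ifP => [_ _|ne /predU1P[ni|]].
    - by exists [set k].
    - by move: ne; rewrite -val_eqE /= ni eqxx.
    - exact: fK.
  have fki0 : fk i0 = ind [set k] by rewrite /fk eqxx.
  have fkne i : i != i0 -> fk i = f i by rewrite /fk => /negPf ->.
  have := IH fk (ltnW nm) fk0 fkK; rewrite [X in _ = X -> _](bigD1 i0)//= fki0.
  under [in X in _ = X -> _]eq_bigr do rewrite fkne//.
  rewrite /ind => <-; apply: eq_integral => w _.
  rewrite -EFinM [in RHS](bigD1 i0)//= fki0; congr (_ * _)%:E.
  by apply: eq_bigr => i ne; rewrite fkne.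
have p0 : (0 <= \prod_(i | i != i0) \int[P]_w (f i (N i w))%:E)%E.
  elim/big_ind : _ => // [x y|i _]; first exact: mule_ge0.
  by apply: integral_ge0 => w _; rewrite lee_fin.
have mf0 : measurable_fun setT (fun w => (f i0 (N i0 w))%:E).
  exact/measurable_EFinP.
rewrite (bigD1 i0)//= -ge0_integralZr//; last first.
  by move=> w _; rewrite lee_fin.
rewrite (@integral_fibers (N i0) (f i0) (cst _))//.
apply: eq_eseriesr => k _; rewrite step ge0_integralZr//.
by apply/measurable_EFinP; apply: measurable_indic.
Qed.
End counts.

(** * Mean and generating function of a Poisson count *)

Section poisson_expectations.
Context {R : realType} {d : measure_display} {T : measurableType d}.
Variables (P : probability T R) (N : T -> nat) (lam : R).
Hypotheses (lam_gt0 : 0 < lam)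
  (N_meas : forall k, measurable [set w | N w = k])
  (N_law : forall k, P [set w | N w = k] = poisson_prob lam k [set k]).

Lemma poisson_series (l : R) : 0 < l ->
  (\sum_(k <oo) (poisson_pmf l k)%:E = 1)%E.
Proof.
move=> l0; have := probability_setT (poisson_prob l 0).
rewrite /= /poisson_prob l0 => <-.
by rewrite nneseries_esumT// => k; rewrite lee_fin poisson_pmf_ge0.
Qed.

Lemma poisson_expectation (f : nat -> R) : (forall k, 0 <= f k) ->
  (\int[P]_w (f (N w))%:E = \sum_(k <oo) (f k * poisson_pmf lam k)%:E)%E.
Proof.
move=> f0; have := @integral_fibers _ _ _ P N f (cst 1%E) N_meas f0.
under eq_integral do rewrite mule1.
move=> -> //; apply: eq_eseriesr => k _.
under eq_integral do rewrite mule1.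
rewrite integral_indic// setIT [X in (_ * X)%E]N_law /poisson_prob lam_gt0 esum_set1//.
by rewrite lee_fin poisson_pmf_ge0.
Qed.

Lemma poisson_mean : (\int[P]_w ((N w)%:R)%:E = lam%:E)%E.
Proof.
rewrite (poisson_expectation (f := fun k => k%:R))//.
rewrite nneseries_recl//; last first.
  by move=> k _; rewrite lee_fin mulr_ge0 ?poisson_pmf_ge0.
rewrite mul0r add0e -nneseries_addn; last first.
  by move=> k; rewrite lee_fin mulr_ge0 ?poisson_pmf_ge0.
under eq_eseriesr => k _.
  rewrite (_ : (k + 1)%:R * _ = lam * poisson_pmf lam k); last first.
    rewrite /poisson_pmf lam_gt0 addn1 factS exprS natrM.
    have k1 : k.+1%:R != 0 :> R by rewrite pnatr_eq0.
    have kf : k`!%:R != 0 :> R by rewrite pnatr_eq0 -lt0n fact_gt0.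
    by move: (k.+1%:R : R) (k`!%:R : R) k1 kf => x y x0 y0; field; apply/andP.
  rewrite EFinM; over.
rewrite nneseriesZl ?poisson_series ?mule1// => k _.
by rewrite lee_fin poisson_pmf_ge0.
Qed.

(** Weighting by [t ^+ k] turns the law of mean [lam] into a multiple of the law of mean [lam * t],
    whose total mass is 1. The case [t = 0] is apart because that mean has to be positive. *)
Lemma poisson_pgf (t : R) : 0 <= t ->
  (\int[P]_w (t ^+ N w)%:E = (expR (- (lam * (1 - t))))%:E)%E.
Proof.
move=> t0; rewrite (poisson_expectation (f := fun k => t ^+ k)); last first.
  by move=> k; apply: exprn_ge0.
have [->|tn0] := eqVneq t 0.
  rewrite (@nneseriesD1 _ _ 0%N)//; last first.
    by move=> k _; rewrite lee_fin mulr_ge0 ?poisson_pmf_ge0// exprn_ge0.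
  rewrite eseries0 ?adde0; last first.
    by move=> k _ /=; case: k => // k _; rewrite expr0n mul0r.
  by rewrite /poisson_pmf lam_gt0 !expr0 fact0 invr1 !mul1r subr0 mulr1.
have tgt0 : 0 < t by rewrite lt_neqAle eq_sym tn0.
have lt0 : 0 < lam * t by rewrite mulr_gt0.
under eq_eseriesr => k _.
  rewrite (_ : t ^+ k * _ =
    expR (- (lam * (1 - t))) * poisson_pmf (lam * t) k); last first.
    rewrite /poisson_pmf lam_gt0 lt0 exprMn.
    have -> : - (lam * (1 - t)) = - lam + lam * t by ring.
    rewrite expRD [expR (- (lam * t))]expRN.
    have kf : k`!%:R != 0 :> R by rewrite pnatr_eq0 -lt0n fact_gt0.
    have := expR_gt0 (lam * t); move: (expR _) (k`!%:R : R) kf => x y y0 x0.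
    by field; rewrite y0 gt_eqF.
  rewrite EFinM; over.
rewrite nneseriesZl ?poisson_series ?mule1// => k _.
by rewrite lee_fin poisson_pmf_ge0.
Qed.

End poisson_expectations.

(** * Patterns of success and failure in conditionally independent trials *)

Section trials.
Context {R : realType} {d : measure_display} {T : measurableType d} {I : eqType}.
Variables (P : probability T R) (G : set (set T)) (S E : I -> set T)
  (p : I -> T -> R).
Hypothesis trials : cond_indep_trials P G S E p.

(* Inclusion-exclusion, one failing trial at a time. *)
Lemma trials_success_failure (J1 J2 : seq I) (D : set T) :
  uniq (J1 ++ J2) -> G D -> measurable D ->
  (forall i, i \in J1 ++ J2 -> D `<=` S i) ->
  (forall i, i \in J1 ++ J2 -> measurable_fun D (p i)) ->
  (forall i w, i \in J1 ++ J2 -> D w -> 0 <= p i w <= 1) ->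
  (P (D `&` [set w | (forall i, i \in J1 -> E i w) /\
                     (forall i, i \in J2 -> ~ E i w)]) =
   \int[P]_(w in D) (\prod_(i <- J1) p i w * \prod_(i <- J2) (1 - p i w))%:E)%E.
Proof.
move=> + GD mD.
elim: J2 J1 => [|j J2 IH] J1 uJ DS mp p01.
  rewrite cats0 in uJ DS; under eq_integral do rewrite big_nil mulr1.
  rewrite -(cit_prod trials uJ GD DS); congr (P (D `&` _)).
  by apply/seteqP; split => [w []|w].
have perm_eq1 : perm_eq (J1 ++ j :: J2) ((j :: J1) ++ J2).
  by rewrite perm_sym /= perm_sym perm_catC /= perm_cons perm_catC.
have uJ' : uniq ((j :: J1) ++ J2) by rewrite -(perm_uniq perm_eq1).
have memJ' i : i \in (j :: J1) ++ J2 -> i \in J1 ++ j :: J2.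
  by rewrite (perm_mem perm_eq1).
have uJ0 : uniq (J1 ++ J2) by move: uJ' => /= /andP[].
have memJ0 i : i \in J1 ++ J2 -> i \in J1 ++ j :: J2.
  by move=> iJ; apply: memJ'; rewrite /= in_cons iJ orbT.
have IH0 := IH J1 uJ0 (fun i h => DS i (memJ0 i h))
  (fun i h => mp i (memJ0 i h)) (fun i w h => p01 i w (memJ0 i h)).
have IH1 := IH (j :: J1) uJ' (fun i h => DS i (memJ' i h))
  (fun i h => mp i (memJ' i h)) (fun i w h => p01 i w (memJ' i h)).
set A0 := D `&` _ in IH0; set A1 := D `&` _ in IH1.
have mE i := cit_meas trials i.
have mA (K1 K2 : seq I) : measurable (D `&`
    [set w | (forall i, i \in K1 -> E i w) /\ (forall i, i \in K2 -> ~ E i w)]).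
  apply: measurableI => //.
  rewrite (_ : [set w | _] = (\bigcap_(i in [set` K1]) E i) `&`
                             (\bigcap_(i in [set` K2]) ~` E i)); last first.
    by apply/seteqP; split => [w []|w []].
  apply: measurableI; apply: (fin_bigcap_measurable (finite_seq _)) => i _.
    exact: mE.
  by apply: measurableC; exact: mE.
have A10 : A1 `<=` A0.
  move=> w [Dw [E1 E2]]; split=> //; split=> // i iJ; apply: E1.
  by rewrite in_cons iJ orbT.
have -> : D `&` [set w | (forall i, i \in J1 -> E i w) /\
                     (forall i, i \in j :: J2 -> ~ E i w)] = A0 `\` A1.
  apply/seteqP; split => [w [Dw [E1 E2]]|w [[Dw [E1 E2]] nA1]].
    split.
      split=> //; split=> // i iJ; apply: E2.
      by rewrite in_cons iJ orbT.
    by move=> [_ [E3 _]]; apply: (E2 j); rewrite ?mem_head//; apply: E3; rewrite mem_head.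
  split=> //; split=> // i; rewrite in_cons => /predU1P[->|]; last exact: E2.
  move=> Ejw; apply: nA1; split=> //; split=> // k.
  by rewrite in_cons => /predU1P[->|]; [|exact: E1].
rewrite measureD ?(setIidr A10); [|exact: mA|exact: mA|]; last first.
  by rewrite ltey_eq fin_num_measure//; exact: mA.
have mprod (K1 K2 : seq I) : (forall i, i \in K1 ++ K2 -> i \in J1 ++ j :: J2) ->
   measurable_fun D (fun w => \prod_(i <- K1) p i w * \prod_(i <- K2) (1 - p i w)).
  move=> KJ; apply: measurable_funM; apply: measurable_prod => i iK.
    by apply: mp; apply: KJ; rewrite mem_cat iK.
  apply: measurable_funB => //.
  by apply: mp; apply: KJ; rewrite mem_cat iK orbT.
have f_ge0 (K1 K2 : seq I) w : (forall i, i \in K1 ++ K2 -> i \in J1 ++ j :: J2) ->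
   D w -> 0 <= \prod_(i <- K1) p i w * \prod_(i <- K2) (1 - p i w).
  move=> KJ Dw; apply: mulr_ge0; rewrite big_seq; apply: prodr_ge0 => i iK.
    have /(p01 i w)/(_ Dw)/andP[//] : i \in J1 ++ j :: J2.
    by apply: KJ; rewrite mem_cat iK.
  rewrite subr_ge0; have /(p01 i w)/(_ Dw)/andP[//] : i \in J1 ++ j :: J2.
  by apply: KJ; rewrite mem_cat iK orbT.
have split_int : (\int[P]_(w in D) (\prod_(i <- J1) p i w * \prod_(i <- J2) (1 - p i w))%:E =
  \int[P]_(w in D) (\prod_(i <- J1) p i w * \prod_(i <- j :: J2) (1 - p i w))%:E
  + \int[P]_(w in D) (\prod_(i <- j :: J1) p i w * \prod_(i <- J2) (1 - p i w))%:E)%E.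
  rewrite -ge0_integralD//.
  - apply: eq_integral => w _; rewrite !big_cons -EFinD; congr EFin.
    ring.
  - by move=> w Dw; rewrite lee_fin; exact: f_ge0.
  - by apply/measurable_EFinP; exact: mprod.
  - by move=> w Dw; rewrite lee_fin; exact: f_ge0.
  - by apply/measurable_EFinP; exact: mprod.
change ((P A0 - P A1)%E = \int[P]_(w in D)
  (\prod_(i <- J1) p i w * \prod_(i <- j :: J2) (1 - p i w))%:E)%E.
rewrite IH0 split_int -IH1 addeK//.
by rewrite fin_num_measure//; exact: mA.
Qed.

End trials.

(** * Geometry of the torus *)
Section torus_geometry.
Context {R : realType}.
Implicit Types (x y u v : R * R) (a b : R).

Lemma enorm_ge0 u : 0 <= enorm u.
Proof. exact: sqrtr_ge0. Qed.

Lemma ler_enorm u v : `|u.1| <= `|v.1| -> `|u.2| <= `|v.2| ->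
  enorm u <= enorm v.
Proof.
have sq a b : `|a| <= `|b| -> a ^+ 2 <= b ^+ 2.
  rewrite -(real_normK (num_real a)) -(real_normK (num_real b)).
  by rewrite ler_pXn2r ?nnegrE.
by move=> uv1 uv2; apply: ler_wsqrtr; apply: lerD; exact: sq.
Qed.

Lemma enorm_swap a1 a2 : enorm (a1, a2) = enorm (a2, a1) :> R.
Proof. by rewrite /enorm /= addrC. Qed.

Lemma le_enorm1 u : `|u.1| <= enorm u.
Proof.
by rewrite -sqrtr_sqr; apply: ler_wsqrtr; rewrite lerDl sqr_ge0.
Qed.

Lemma le_enorm2 u : `|u.2| <= enorm u.
Proof.
by rewrite -sqrtr_sqr; apply: ler_wsqrtr; rewrite lerDr sqr_ge0.
Qed.

Lemma enormZ (c : R) u : 0 <= c -> enorm (u.1 * c, u.2 * c) = enorm u * c.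
Proof.
move=> c0; rewrite /enorm /= !exprMn -mulrDl sqrtrM ?sqrtr_sqr ?ger0_norm//.
by rewrite addr_ge0 ?sqr_ge0.
Qed.

(** For [|a| <= 1], the distance from [a] to the nearest integer. *)
Definition circle_norm a : R := Num.min `|a| (1 - `|a|).

Lemma circle_norm_le a (z : int) : `|a| <= 1 -> circle_norm a <= `|a + z%:~R|.
Proof.
rewrite /circle_norm ge_min => a1.
have [->|z0] := eqVneq z 0; first by rewrite addr0 lexx.
apply/orP; right.
have : 1 <= `|z%:~R : R|.
  by rewrite -intr_norm (ler_int R 1) -gtz0_ge1 normr_gt0.
by have := ler_normD (a + z%:~R) (- a); rewrite addrAC subrr add0r normrN; lra.
Qed.

Lemma circle_norm_attained a : `|a| <= 1 ->
  exists z : int, `|a + z%:~R| = circle_norm a.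
Proof.
rewrite /circle_norm /Num.min; case: ltP => [_ _|h a1]; first by exists 0; rewrite addr0.
have [a0|a0] := leP 0 a.
  exists (-1); rewrite ger0_norm// in h a1 *.
  by rewrite ler0_norm; lra.
exists 1; rewrite [in RHS]ltr0_norm// ltr0_norm// in a1 *.
by rewrite ger0_norm; lra.
Qed.

Lemma circle_norm_ge0 a : `|a| <= 1 -> 0 <= circle_norm a.
Proof. by move=> a1; rewrite le_min normr_ge0 subr_ge0. Qed.

(** The minimization over the lattice decouples into the two coordinates, and a translate by -1, 0
    or 1 is optimal in each, because the coordinates differ by at most 1. *)
Lemma tdistE x y : `|x.1 - y.1| <= 1 -> `|x.2 - y.2| <= 1 ->
  tdist x y = enorm (circle_norm (x.1 - y.1), circle_norm (x.2 - y.2)).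
Proof.
move=> xy1 xy2; rewrite /tdist; set S := (X in inf X).
have lbS : lbound S (enorm (circle_norm (x.1 - y.1), circle_norm (x.2 - y.2))).
  move=> _ [z _ <-]; apply: ler_enorm => /=.
    by rewrite ger0_norm ?circle_norm_ge0// addrAC circle_norm_le.
  by rewrite ger0_norm ?circle_norm_ge0// addrAC circle_norm_le.
apply/eqP; rewrite eq_le; apply/andP; split; last first.
  by apply: lb_le_inf => //; exists (enorm (x + (0%:~R, 0%:~R) - y)), (0, 0).
have [z1 z1E] := circle_norm_attained xy1.
have [z2 z2E] := circle_norm_attained xy2.
have : S (enorm (x + (z1%:~R, z2%:~R) - y)) by exists (z1, z2).
move/(ge_inf (ex_intro _ _ lbS)) => /le_trans; apply.
by apply: ler_enorm => /=; rewrite addrAC (z1E, z2E) ler_norm.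
Qed.

Lemma unit_square_diff x y : unit_square x -> unit_square y ->
  `|x.1 - y.1| <= 1 /\ `|x.2 - y.2| <= 1.
Proof.
move=> [/andP[x1 x1'] /andP[x2 x2']] [/andP[y1 y1'] /andP[y2 y2']].
by rewrite !ler_norml; split; lra.
Qed.

Lemma tdist_edist x y : `|x.1 - y.1| <= 2^-1 -> `|x.2 - y.2| <= 2^-1 ->
  tdist x y = Defs.edist x y.
Proof.
move=> xy1 xy2; rewrite tdistE; [|lra|lra].
have cn a : `|a| <= 2^-1 -> circle_norm a = `|a|.
  by move=> a2; apply/min_idPl; lra.
by rewrite !cn// /Defs.edist /enorm /= !real_normK ?num_real.
Qed.

Lemma tdist_ge0 x y : unit_square x -> unit_square y -> 0 <= tdist x y.
Proof.
by move=> xA yA; have [? ?] := unit_square_diff xA yA;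
  rewrite tdistE ?enorm_ge0.
Qed.

Lemma tdistC x y : unit_square x -> unit_square y -> tdist x y = tdist y x.
Proof.
move=> xA yA; have [? ?] := unit_square_diff xA yA.
have [? ?] := unit_square_diff yA xA.
by rewrite !tdistE// /circle_norm (distrC x.1) (distrC x.2).
Qed.

Lemma circle_norm_le_tdist1 x y : unit_square x -> unit_square y ->
  circle_norm (x.1 - y.1) <= tdist x y.
Proof.
move=> xA yA; have [xy1 xy2] := unit_square_diff xA yA; rewrite tdistE//.
by apply: le_trans (le_enorm1 _) => /=; rewrite ler_norm.
Qed.

Lemma circle_norm_le_tdist2 x y : unit_square x -> unit_square y ->
  circle_norm (x.2 - y.2) <= tdist x y.
Proof.
move=> xA yA; have [xy1 xy2] := unit_square_diff xA yA; rewrite tdistE//.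
by apply: le_trans (le_enorm2 _) => /=; rewrite ler_norm.
Qed.

Lemma measurable_sqrt : measurable_fun setT (@Num.sqrt R).
Proof. by apply: nondecreasing_measurable => // a b; exact: ler_wsqrtr. Qed.

Lemma measurable_circle_norm : measurable_fun setT circle_norm.
Proof.
apply: measurable_minr; first exact: normr_measurable.
by apply: measurable_funB => //; exact: normr_measurable.
Qed.

End torus_geometry.

(** * The expected number of newly isolated nodes for a partition into cells *)
Section measurability_of_positions.
Context {R : realType} {d : measure_display} {T : measurableType d}.
Variables (pts : T -> seq (R * R)) (I : finType) (cell : R * R -> I).
Hypotheses (pts_sub : forall w x, x \in pts w -> unit_square x)
  (pts_meas : forall i B, measurable B -> measurable (node_in pts i B))
  (cell_meas : forall c, measurable (unit_square `&` cell @^-1` [set c])).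

Lemma node_unit_square i w : (i < size (pts w))%N -> unit_square (node pts i w).
Proof. by move=> iw; apply: (pts_sub (w := w)); exact: mem_nth. Qed.

Lemma measurable_size n : measurable [set w | size (pts w) = n].
Proof.
have -> : [set w | size (pts w) = n] =
    (if n is n'.+1 then node_in pts n' setT else setT) `\` node_in pts n setT.
  apply/seteqP; split => [w /= <-|w].
    split; last by rewrite /node_in /= ltnn => -[].
    by case E : (size (pts w)) => [|n'] //; split=> //; rewrite E.
  case=> Hn Hn'; apply/eqP; rewrite eqn_leq; apply/andP; split.
    by rewrite leqNgt; apply/negP => ?; apply: Hn'.
  by case: n Hn {Hn'} => // n [].
apply: measurableD; last exact: pts_meas.
by case: n => // n; exact: pts_meas.
Qed.

(** The sigma-algebra on [T] is a parameter of the section. The lemma is also applied to the one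
    generated by the node positions, which makes a prescribed sequence of cells a legitimate
    conditioning event for the torus connections. *)
Lemma measurable_cells (s : seq I) : measurable [set w | map cell (pts w) = s].
Proof.
have -> : [set w | map cell (pts w) = s] = [set w | size (pts w) = size s] `&`
    \bigcap_(i < size s) \bigcup_(c in [set c | onth s i = Some c])
      node_in pts i (unit_square `&` cell @^-1` [set c]).
  apply/seteqP; split => [w /= <-|w /= [ws wi]].
    rewrite size_map; split=> // i /= iw; exists (cell (node pts i w)).
      by rewrite /= onth_map /node onthE (nth_map 0).
    split=> //; split=> //; exact: node_unit_square.
  apply: (@eq_from_nth _ (cell 0)); rewrite size_map// => i iw.
  have := wi i; rewrite /= -ws => /(_ iw)[c /= sc [_ [_ /= ci]]].
  rewrite (nth_map 0)//; move: sc; rewrite onthE (nth_map (cell 0)) -?ws//.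
  by move=> [->].
apply: measurableI; first exact: measurable_size.
apply: (fin_bigcap_measurable (finite_II _)) => i _.
apply: fin_bigcup_measurable => [|c _]; first exact: finite_finset.
exact: pts_meas.
Qed.

Lemma measurable_node i D : measurable D -> (forall w, D w -> (i < size (pts w))%N) ->
  measurable_fun D (node pts i).
Proof.
move=> mD Di _ Y mY.
have -> : D `&` node pts i @^-1` Y = D `&` node_in pts i Y.
  apply/seteqP; split => [w [Dw Yw]|w [Dw [_ Yw]]]; split=> //.
  by split=> //; exact: Di.
by apply: measurableI => //; exact: pts_meas.
Qed.

Variables (g : R -> R) (r : R).
Hypotheses (g_noninc : forall x y : R, 0 <= x -> x <= y -> g y <= g x)
  (r_gt0 : 0 < r).

Lemma measurable_torus_prob ij D : measurable D ->
  D `<=` pair_event pts ij -> measurable_fun D (torus_prob g r pts ij).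
Proof.
case: ij => i j mD Dij.
have Di w : D w -> (i < size (pts w))%N.
  by move=> /Dij /= /andP[ij jw]; exact: ltn_trans jw.
have Dj w : D w -> (j < size (pts w))%N by move=> /Dij /= /andP[].
(* [g] is controlled on nonnegative arguments only; the truncation is monotone on the whole line,
   hence measurable. *)
pose g' x := g (Num.max 0 x).
have mg' : measurable_fun setT g'.
  apply: nonincreasing_measurable => // x y xy; apply: g_noninc.
    by rewrite le_max lexx.
  by rewrite ge_max le_max lexx /= le_max xy orbT.
pose f w := g' (enorm (circle_norm ((node pts i w).1 - (node pts j w).1),
  circle_norm ((node pts i w).2 - (node pts j w).2)) / r).
have mf : measurable_fun D f.
  apply: measurableT_comp mg' _.
  apply: measurable_funM => //.
  apply: (measurableT_comp measurable_sqrt).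
  have m1 k : (forall w, D w -> (k < size (pts w))%N) ->
      measurable_fun D (fun w => (node pts k w).1).
    by move=> Dk; apply: measurableT_comp => //; exact: measurable_node.
  have m2 k : (forall w, D w -> (k < size (pts w))%N) ->
      measurable_fun D (fun w => (node pts k w).2).
    by move=> Dk; apply: measurableT_comp => //; exact: measurable_node.
  by apply: measurable_funD; apply: measurable_funX;
    apply: (measurableT_comp measurable_circle_norm);
    apply: measurable_funB; (exact: m1 || exact: m2).
apply: eq_measurable_fun mf => w; rewrite inE => Dw.
have xA := node_unit_square (Di w Dw); have yA := node_unit_square (Dj w Dw).
have [? ?] := unit_square_diff xA yA.
rewrite /f /g' /torus_prob /= tdistE//; congr g; apply/max_idPr.
by rewrite divr_ge0 ?enorm_ge0 ?ltW.
Qed.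

End measurability_of_positions.

Lemma ltn_minn_maxn i j n : (i < n)%N -> (j < n)%N -> j != i ->
  (minn i j < maxn i j < n)%N.
Proof. by lia. Qed.

(** * Union bound given the cells, then expectation over the cell counts *)

Section boundary_bound.
Context {R : realType} {d : measure_display} {T : measurableType d}.
Variables (P : probability T R) (g : R -> R) (r rho : R).
Variables (pts : T -> seq (R * R)) (conn removed : T -> rel nat).
Hypotheses (bc : boundary_coupling P g r rho pts conn removed)
  (g_range : forall x : R, 0 <= x -> 0 <= g x <= 1)
  (g_noninc : forall x y : R, 0 <= x -> x <= y -> g y <= g x)
  (r_gt0 : 0 < r).
Variables (I : finType) (cell : R * R -> I) (near : rel I) (bd : pred I)
  (v u : I -> I -> R).
Hypotheses
  (cell_meas : forall c, measurable (unit_square `&` cell @^-1` [set c]))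
  (near_refl : reflexive near) (near_sym : symmetric near)
  (near_dist : forall x y, unit_square x -> unit_square y ->
    near (cell x) (cell y) -> tdist x y = Defs.edist x y)
  (v01 : forall c c', 0 <= v c c' <= 1)
  (v_diag : forall c, v c c = 0)
  (v_far : forall c c', ~~ near c c' -> v c c' = 0)
  (v_le : forall x y, unit_square x -> unit_square y ->
    v (cell x) (cell y) <= g (tdist x y / r))
  (u_ge0 : forall c c', 0 <= u c c')
  (u_near : forall c c', near c c' -> u c c' = 0)
  (u_ge : forall x y, unit_square x -> unit_square y -> ~~ bd (cell x) ->
    ~~ near (cell x) (cell y) -> g (tdist x y / r) <= u (cell x) (cell y)).

Let pts_sub w x : x \in pts w -> unit_square x.
Proof. exact: (pp_sub (bc_nodes bc)). Qed.

Let pts_meas i B : measurable B -> measurable (node_in pts i B).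
Proof. exact: (pp_meas (bc_nodes bc)). Qed.

Let G := <<s position_events pts >>.

Let G_node i B : measurable B ->
  @measurable _ (g_sigma_algebraType (position_events pts)) (node_in pts i B).
Proof. by move=> mB; apply: sub_sigma_algebra; exists i, B. Qed.

Let G_meas D : G D -> measurable D.
Proof.
move: D; apply: smallest_sub; first exact: sigma_algebra_measurable.
by move=> _ [i [B [mB ->]]]; exact: pts_meas.
Qed.

(** Fixing the whole sequence of cells, and not only the counts, also fixes the number of nodes and
    the values of [v] and [u] between any two listed nodes. These events form a countable
    partition. *)
Let Ds (s : seq I) := [set w | map cell (pts w) = s].

Let Ds_G s : G (Ds s).
Proof.
exact: (@measurable_cells R _ (g_sigma_algebraType (position_events pts)) pts
  I cell pts_sub G_node cell_meas s).
Qed.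

Let Ds_meas s : measurable (Ds s).
Proof. exact: G_meas. Qed.

Let mconn ij : measurable (conn_event pts conn ij).
Proof. exact: (cit_meas (bc_torus bc)). Qed.

Let mremoval ij : measurable (removal_event pts conn removed ij).
Proof. exact: (cit_meas (bc_removal bc)). Qed.

Let Ds_node s i w : Ds s w -> (i < size s)%N ->
  [/\ (i < size (pts w))%N, unit_square (node pts i w) &
      forall c0, cell (node pts i w) = nth c0 s i].
Proof.
move=> <-; rewrite size_map => iw; split=> //.
  exact: (node_unit_square pts_sub).
by move=> c0; rewrite (nth_map 0).
Qed.

(** Equal distances make the removal probability [1 - q / q], which is 0 unless [q = 0]. Where
    [q = 0], the convention [0 / 0 = 0] makes it 1, but there (the event [Z]) the connection itself
    has probability 0. *)
Lemma removal_near_null s c0 i j : (i < j < size s)%N ->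
  near (nth c0 s i) (nth c0 s j) ->
  P (Ds s `&` removal_event pts conn removed (i, j)) = 0%E.
Proof.
move=> /andP[ij js] nij.
have is' : (i < size s)%N := ltn_trans ij js.
set ev := conn_event pts conn (i, j).
pose Z := Ds s `&` [set w | torus_prob g r pts (i, j) w = 0].
have Dpair : Ds s `<=` pair_event pts (i, j).
  move=> w Dw; have [jw _ _] := Ds_node Dw js.
  by rewrite /pair_event /= ij jw.
have GZ : G Z.
  have mT : @measurable_fun _ _ (g_sigma_algebraType (position_events pts)) R
      (Ds s) (torus_prob g r pts (i, j)).
    apply: (@measurable_torus_prob _ _ (g_sigma_algebraType (position_events pts))) => //.
    exact: Ds_G.
  exact: (mT (Ds_G s) [set 0]).
have Z0 : P (Z `&` ev) = 0%E.
  have := cit_prod (bc_torus bc) (J := [:: (i, j)]) (D := Z) isT GZ.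
  have -> : [set w | forall k, k \in [:: (i, j)] -> conn_event pts conn k w] = ev.
    apply/seteqP; split => [w /(_ (i, j))|w evw k]; first by rewrite mem_head; exact.
    by rewrite inE => /eqP ->.
  move=> ->; last by move=> k; rewrite inE => /eqP -> w [/Dpair].
  rewrite (eq_integral (cst 0%E)) ?integral0// => w; rewrite inE => -[_ w0].
  by rewrite big_seq1 w0.
have GD : <<s position_events pts `|` range (conn_event pts conn) >> (Ds s `&` ev).
  apply: (@measurableI _ (g_sigma_algebraType _)).
    apply: (sub_smallest2r (@smallest_sigma_algebra _ _ _)) (Ds_G s).
    by move=> ? ?; left.
  by apply: sub_sigma_algebra; right; exists (i, j).
have := cit_prod (bc_removal bc) (J := [:: (i, j)]) isT GD.
have -> : Ds s `&` ev `&` [set w | forall k, k \in [:: (i, j)] ->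
    removal_event pts conn removed k w] =
    Ds s `&` removal_event pts conn removed (i, j).
  apply/seteqP; split => [w [[Dw _]] /(_ (i, j))|w [Dw [cw rw]]].
    by rewrite mem_head => /(_ isT).
  by split=> // k; rewrite inE => /eqP ->.
move=> ->; last by move=> k; rewrite inE => /eqP -> w [].
have mDs := Ds_meas s.
rewrite (eq_integral (fun w => (\1_Z w)%:E)); last first.
  move=> w; rewrite inE => -[Dw _]; rewrite big_seq1; congr EFin.
  have [iw iA ic] := Ds_node Dw is'; have [jw jA jc] := Ds_node Dw js.
  have -> : square_prob g r pts (i, j) w = torus_prob g r pts (i, j) w.
    rewrite /square_prob /torus_prob /= near_dist//.
    by rewrite (ic c0) (jc c0).
  rewrite indicE; have [T0|T0] := eqVneq (torus_prob g r pts (i, j) w) 0.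
    by rewrite T0 mul0r subr0 mem_set.
  rewrite divff// subrr memNset// => -[_ /= Z0'].
  by move: T0; rewrite Z0' eqxx.
rewrite integral_indic.
- apply/eqP; rewrite eq_le measure_ge0 andbT -Z0 le_measure ?inE//.
  + apply: measurableI; first exact: G_meas.
    by apply: measurableI; [exact: Ds_meas|exact: mconn].
  + by apply: measurableI; [exact: G_meas|exact: mconn].
  + by move=> w [Zw [_ ew]].
- by apply: measurableI; [exact: Ds_meas|exact: mconn].
- exact: G_meas.
Qed.

Let pr (i j : nat) : nat * nat := (minn i j, maxn i j).

Let pr_inj i : injective (pr i).
Proof.
move=> j k [mn mx]; apply/eqP.
by rewrite -(eqn_add2l i) -[(i + j)%N]addn_min_max -[(i + k)%N]addn_min_max mn mx.
Qed.

Let pair_pr i j w : (i < size (pts w))%N -> (j < size (pts w))%N -> j != i ->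
  pair_event pts (pr i j) w.
Proof.
exact: ltn_minn_maxn.
Qed.

Lemma WE_neq0P w : WE pts conn removed w <> 0%N <->
  exists2 i, (i < size (pts w))%N &
    (forall j, (j < size (pts w))%N -> j != i -> conn_event pts conn (pr i j) w ->
       removal_event pts conn removed (pr i j) w) /\
    (exists2 j, (j < size (pts w))%N & j != i /\ conn_event pts conn (pr i j) w).
Proof.
split.
  rewrite /WE => /eqP; rewrite -lt0n => /card_gt0P[i]; rewrite inE.
  move=> /andP[/forallP isok nisoc]; exists i => //; split.
    move=> j jw ji cij; split=> //; have := isok (Ordinal jw).
    rewrite /linked /kept /= eq_sym ji /=; case: cij => _ /= -> /=.
    by rewrite negbK.
  move: nisoc => /forallPn[j]; rewrite negbK => /andP[ij cij]; exists j => //.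
  by rewrite eq_sym; split=> //; split=> //; apply: pair_pr => //; rewrite eq_sym.
move=> [i iw [rem [j jw [ji cij]]]].
apply/eqP; rewrite -lt0n; apply/card_gt0P; exists (Ordinal iw).
rewrite inE; apply/andP; split.
  apply/forallP => k; rewrite /linked /kept /=.
  apply/negP => /and3P[ik ck]; apply/negP; rewrite negbK.
  have ki : k != i :> nat by rewrite eq_sym.
  have /rem : (k < size (pts w))%N by [].
  move=> /(_ ki)[]; last by [].
  by split=> //; apply: pair_pr.
apply/forallPn; exists (Ordinal jw); rewrite negbK /linked /= eq_sym ji /=.
by case: cij.
Qed.

Lemma measurable_WE_neq0 : measurable [set w | WE pts conn removed w <> 0%N].
Proof.
have -> : [set w | WE pts conn removed w <> 0%N] =
  \bigcup_n ([set w | size (pts w) = n] `&` \bigcup_(i in `I_n)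
    ((\bigcap_(j in [set j | (j < n)%N /\ j != i])
       (~` conn_event pts conn (pr i j) `|` removal_event pts conn removed (pr i j))) `&`
     (\bigcup_(j in [set j | (j < n)%N /\ j != i]) conn_event pts conn (pr i j)))).
  apply/seteqP; split => [w /WE_neq0P[i iw [rem [j jw [ji cij]]]]|
    w [n _ [/= <-] [i iw [rem [j [jw ji] cij]]]]].
    exists (size (pts w)) => //; split=> //; exists i => //; split; last by exists j.
    move=> k [kw ki]; have [ck|nck] := pselect (conn_event pts conn (pr i k) w).
      by right; exact: rem.
    by left.
  apply/WE_neq0P; exists i => //; split; last by exists j.
  by move=> k kw ki ck; have [] := rem k (conj kw ki).
apply: bigcup_measurable => n _; apply: measurableI.
  exact: (measurable_size pts_meas).
apply: bigcup_measurable => i _; apply: measurableI; last first.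
  by apply: bigcup_measurable => j _; exact: mconn.
apply: bigcap_measurableType => j _; apply: measurableU; last exact: mremoval.
by apply: measurableC; exact: mconn.
Qed.

Let c0 := cell 0.

Let torus_pr s i j w : Ds s w -> (i < size s)%N -> (j < size s)%N ->
  torus_prob g r pts (pr i j) w = g (tdist (node pts i w) (node pts j w) / r).
Proof.
move=> Dw /(Ds_node Dw)[iw iA _] /(Ds_node Dw)[jw jA _].
by rewrite /torus_prob /pr; case: (leqP i j) => //= _; rewrite tdistC.
Qed.

Let nbrs (s : seq I) i := [seq pr i j | j <- iota 0 (size s) &
  (j != i) && near (nth c0 s i) (nth c0 s j)].

(** [K] lists far nodes to which node [i] is connected: it will be empty for a boundary cell and a
    singleton otherwise. The product of [1 - v] may run over all of [s] because [v] vanishes at the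
    cell of [i] itself and on far cells. *)
Lemma isolated_near_bound s i (K : seq nat) : (i < size s)%N -> uniq K ->
  (forall k, k \in K -> [/\ (k < size s)%N, ~~ near (nth c0 s i) (nth c0 s k)
    & ~~ bd (nth c0 s i)]) ->
  (P (Ds s `&` [set w |
       (forall e, e \in map (pr i) K -> conn_event pts conn e w) /\
       (forall e, e \in nbrs s i -> ~ conn_event pts conn e w)]) <=
   (\prod_(k <- K) u (nth c0 s i) (nth c0 s k) *
    \prod_(c <- s) (1 - v (nth c0 s i) c))%:E * P (Ds s))%E.
Proof.
move=> is_ uK K_far.
have memJ e : e \in map (pr i) K ++ nbrs s i ->
    exists2 j, [/\ (j < size s)%N, j != i &
      (~~ near (nth c0 s i) (nth c0 s j) -> ~~ bd (nth c0 s i))] & e = pr i j.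
  rewrite mem_cat => /orP[/mapP[k kK ->]|/mapP[j + ->]].
    have [ks far nbd] := K_far k kK; exists k => //; split=> //.
    by apply: contraNneq far => ->; exact: near_refl.
  rewrite mem_filter mem_iota add0n => /andP[/andP[ji near_ij] js]; exists j => //.
  by split=> //; rewrite near_ij.
have Dpair e : e \in map (pr i) K ++ nbrs s i -> Ds s `<=` pair_event pts e.
  move=> /memJ[j [js ji _] ->] w Dw.
  have [iw _ _] := Ds_node Dw is_; have [jw _ _] := Ds_node Dw js.
  exact: pair_pr.
have mp e : e \in map (pr i) K ++ nbrs s i ->
    measurable_fun (Ds s) (torus_prob g r pts e).
  by move=> eJ; apply: (measurable_torus_prob pts_sub pts_meas) => //; exact: Dpair.
have p01 e w : e \in map (pr i) K ++ nbrs s i -> Ds s w ->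
    0 <= torus_prob g r pts e w <= 1.
  move=> /memJ[j [js ji _] ->] Dw; rewrite (torus_pr Dw)//.
  have [iw iA _] := Ds_node Dw is_; have [jw jA _] := Ds_node Dw js.
  by apply: g_range; rewrite divr_ge0 ?(ltW r_gt0)// tdist_ge0.
have uJ : uniq (map (pr i) K ++ nbrs s i).
  rewrite /nbrs -map_cat map_inj_uniq ?cat_uniq ?uK ?filter_uniq ?iota_uniq ?andbT//.
  apply/hasPn => j; rewrite mem_filter => /andP[/andP[_ nij] _].
  by apply/negP => /K_far[_]; rewrite nij.
rewrite (trials_success_failure (bc_torus bc) uJ (Ds_G s) (Ds_meas s) Dpair mp p01).
have prod01 w : Ds s w ->
    0 <= \prod_(e <- map (pr i) K) torus_prob g r pts e w *
         \prod_(e <- nbrs s i) (1 - torus_prob g r pts e w).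
  move=> Dw; apply: mulr_ge0; rewrite big_seq; apply: prodr_ge0 => e eK.
    by have /(p01 e w)/(_ Dw)/andP[] : e \in map (pr i) K ++ nbrs s i by rewrite mem_cat eK.
  rewrite subr_ge0.
  by have /(p01 e w)/(_ Dw)/andP[] : e \in map (pr i) K ++ nbrs s i by rewrite mem_cat eK orbT.
rewrite -(integral_cst _ (Ds_meas s)).
apply: ge0_le_integral => //.
  apply/measurable_EFinP; apply: measurable_funM; apply: measurable_prod => e eK.
    by apply: mp; rewrite mem_cat eK.
  by apply: measurable_funB => //; apply: mp; rewrite mem_cat eK orbT.
move=> w Dw; rewrite lee_fin; have [iw iA ic] := Ds_node Dw is_.
apply: ler_pM.
- rewrite big_seq; apply: prodr_ge0 => e eK.
  by have /(p01 e w)/(_ Dw)/andP[] : e \in map (pr i) K ++ nbrs s i by rewrite mem_cat eK.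
- rewrite big_seq; apply: prodr_ge0 => e eK; rewrite subr_ge0.
  by have /(p01 e w)/(_ Dw)/andP[] : e \in map (pr i) K ++ nbrs s i by rewrite mem_cat eK orbT.
- rewrite big_map !big_seq; apply: ler_prod => k kK.
  have [ks far nbd] := K_far k kK; have [kw kA kc] := Ds_node Dw ks.
  have /(p01 _ w)/(_ Dw)/andP[-> _] : pr i k \in map (pr i) K ++ nbrs s i.
    by rewrite mem_cat map_f.
  by rewrite (torus_pr Dw)//= -(ic c0) -(kc c0) u_ge// (ic c0) ?(kc c0).
rewrite big_map big_filter.
apply: (@le_trans _ _ (\prod_(j <- iota 0 (size s) |
    (j != i) && near (nth c0 s i) (nth c0 s j)) (1 - v (nth c0 s i) (nth c0 s j)))).
  rewrite big_seq_cond [X in _ <= X]big_seq_cond; apply: ler_prod => j /andP[].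
  rewrite mem_iota add0n => /= js jN; have [jw jA jc] := Ds_node Dw js.
  have /(p01 _ w)/(_ Dw)/andP[_ p1] : pr i j \in map (pr i) K ++ nbrs s i.
    rewrite mem_cat; apply/orP; right; apply: map_f.
    by rewrite mem_filter jN mem_iota.
  rewrite subr_ge0 p1 /= lerD2l lerN2 (torus_pr Dw)// -(ic c0) -(jc c0).
  exact: v_le.
rewrite (big_nth c0) /index_iota subn0 big_mkcond /= le_eqVlt; apply/orP; left.
apply/eqP; apply: eq_bigr => j _; case: ifP => //.
have [->|ji /= /negbT nij] := eqVneq j i; first by rewrite v_diag subr0.
by rewrite v_far// subr0.
Qed.

Let psi (s : seq I) : R := \sum_(c <- s)
  ((bd c)%:R + \sum_(c' <- s) u c c') * \prod_(c' <- s) (1 - v c c').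

Lemma WE_cells_bound s :
  (P ([set w | WE pts conn removed w <> 0%N] `&` Ds s) <=
   (psi s)%:E * P (Ds s))%E.
Proof.
pose iso i K := Ds s `&` [set w |
       (forall e, e \in map (pr i) K -> conn_event pts conn e w) /\
       (forall e, e \in nbrs s i -> ~ conn_event pts conn e w)].
have miso i K : measurable (iso i K).
  apply: measurableI; first exact: Ds_meas.
  rewrite (_ : [set w | _] = (\bigcap_(e in [set` map (pr i) K]) conn_event pts conn e) `&`
                             (\bigcap_(e in [set` nbrs s i]) ~` conn_event pts conn e)); last first.
    by apply/seteqP; split => [w []|w []].
  apply: measurableI; apply: (fin_bigcap_measurable (finite_seq _)) => e _.
    exact: mconn.
  by apply: measurableC; exact: mconn.
pose c i := nth c0 s i.
(* [Rm] collects the null removals between near cells. Off them, [E0] covers a node in a boundary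
   cell whatever its far connections, so that [u] has to dominate [g] only away from the boundary;
   [E1] covers the other nodes, with one far neighbour [k], which exists because the node was not
   isolated on the torus. *)
pose Rm i j := if (j != i) && near (c i) (c j)
  then Ds s `&` removal_event pts conn removed (pr i j) else set0.
pose E0 i := if bd (c i) then iso i [::] else set0.
pose E1 i k := if ~~ near (c i) (c k) && ~~ bd (c i) then iso i [:: k] else set0.
have mRm i j : measurable (Rm i j).
  by rewrite /Rm; case: ifP => // _; apply: measurableI; [exact: Ds_meas|exact: mremoval].
have mE0 i : measurable (E0 i) by rewrite /E0; case: ifP.
have mE1 i k : measurable (E1 i k) by rewrite /E1; case: ifP.
pose n := size s.
pose U i := \big[setU/set0]_(j < n) (Rm i j `|` E1 i j).
have mU i : measurable (U i).
  by apply: bigsetU_measurable => j _; exact: measurableU.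
have sub : [set w | WE pts conn removed w <> 0%N] `&` Ds s `<=`
    \big[setU/set0]_(i < n) (E0 i `|` U i).
  move=> w [/WE_neq0P[i iw [rem [k kw [ki cik]]]] Dw].
  have sw : size (pts w) = n by rewrite -(size_map cell) [map _ _]Dw.
  rewrite sw in iw kw rem.
  rewrite -(bigcup_mkord n (fun i => E0 i `|` U i)); exists i => //.
  have inU j : (j < n)%N -> (Rm i j `|` E1 i j) w -> U i w.
    move=> jn Rj; rewrite /U -(bigcup_mkord n (fun j => Rm i j `|` E1 i j)).
    by exists j.
  have [[j /and3P[jn ji nij] cij]|nonear] := pselect (exists2 j,
      [&& (j < n)%N, j != i & near (c i) (c j)] & conn_event pts conn (pr i j) w).
    right; apply: (inU j jn); left; rewrite /Rm ji nij; split=> //.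
    exact: rem.
  have isoK K : (forall e, e \in map (pr i) K -> conn_event pts conn e w) -> iso i K w.
    move=> Kc; split=> //; split=> // _ /mapP[j + ->] cij.
    rewrite mem_filter mem_iota => /andP[/andP[ji nij] /andP[_ jn]].
    by apply: nonear; exists j => //; apply/and3P; split.
  have [bi|nbi] := boolP (bd (c i)).
    by left; rewrite /E0 bi; exact: isoK.
  right; apply: (inU k kw); right; rewrite /E1 nbi andbT ifT.
    by apply: isoK => e; rewrite inE => /eqP ->.
  by apply/negP => nik; apply: nonear; exists k; rewrite // kw ki.
have Dfin : P (Ds s) \is a fin_num by rewrite fin_num_measure//; exact: Ds_meas.
have [q Pq] : exists q, P (Ds s) = q%:E by exists (fine (P (Ds s))); rewrite fineK.
have q0 : 0 <= q by rewrite -lee_fin -Pq.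
pose pv i := \prod_(c' <- s) (1 - v (c i) c').
have pv0 i : 0 <= pv i.
  by apply: prodr_ge0 => c' _; rewrite subr_ge0; case/andP: (v01 (c i) c').
have PRm (i j : 'I_n) : P (Rm i j) = 0%E.
  rewrite /Rm; case: ifP => // /andP[ji nij]; rewrite /pr.
  case: (ltngtP i j) => [ij|ij|/val_inj ij]; last by rewrite ij eqxx in ji.
    by apply: (@removal_near_null _ c0); rewrite ?ij ?ltn_ord.
  by apply: (@removal_near_null _ c0); rewrite 1?near_sym ?ij ?ltn_ord.
have PE0 (i : 'I_n) : (P (E0 i) <= ((bd (c i))%:R * pv i * q)%:E)%E.
  rewrite /E0; case: ifP => // _; last by rewrite measure0 !mul0r.
  rewrite EFinM -Pq; apply: le_trans (@isolated_near_bound s i [::] _ _ _) _ => //.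
  by rewrite big_nil.
have PE1 (i k : 'I_n) : (P (E1 i k) <= (u (c i) (c k) * pv i * q)%:E)%E.
  rewrite /E1; case: ifP => [/andP[nik nbi]|_]; last first.
    by rewrite measure0 lee_fin !mulr_ge0.
  rewrite EFinM -Pq; apply: le_trans (@isolated_near_bound s i [:: val k] _ _ _) _ => //.
    by move=> j; rewrite inE => /eqP ->; split=> //; exact: ltn_ord.
  by rewrite big_seq1.
have PU (i : 'I_n) : (P (U i) <= ((\sum_(c' <- s) u (c i) c') * pv i * q)%:E)%E.
  apply: le_trans.
    apply: (@Boole_inequality _ _ _ P (fun j : nat => Rm i j `|` E1 i j) n).
    by move=> j _; exact: measurableU.
  apply: (@le_trans _ _ (\sum_(k < n) (u (c i) (c k) * pv i * q)%:E)%E).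
    apply: lee_sum => k _; apply: le_trans (measureU2 _ _ _) _ => //.
    by rewrite [X in (X + _)%E]PRm add0e; exact: PE1.
  by rewrite sumEFin lee_fin (big_nth c0) big_mkord -!mulr_suml.
apply: le_trans (le_measure _ _ _ sub) _; rewrite ?inE.
- by apply: measurableI; [exact: measurable_WE_neq0|exact: Ds_meas].
- by apply: bigsetU_measurable => i _; exact: measurableU.
apply: le_trans.
  apply: (@Boole_inequality _ _ _ P (fun i : nat => E0 i `|` U i) n).
  by move=> i _; exact: measurableU.
rewrite Pq -EFinM /psi (big_nth c0) big_mkord mulr_suml -sumEFin.
apply: lee_sum => i _; apply: le_trans (measureU2 _ _ _) _ => //.
rewrite !mulrDl EFinD; apply: leeD; first exact: PE0.
exact: PU.
Qed.

Variable lam : R.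
Hypotheses (lam_gt0 : 0 < lam)
  (cell_lam : forall c,
     rho * fine (area (unit_square `&` cell @^-1` [set c])) = lam).

(** Cell sequences are encoded as natural numbers so that the decompositions over the values of a
    count apply to them. *)
Let code w : nat := pickle (map cell (pts w)).

Let code_fiber s : [set w | code w = pickle s] = Ds s.
Proof.
apply/seteqP; split => w /=; rewrite /code; last by move=> ->.
exact: (pcan_inj pickleK).
Qed.

Let code_meas k : measurable [set w | code w = k].
Proof.
have [[s <-]|nk] := pselect (exists s : seq I, pickle s = k).
  by rewrite code_fiber; exact: Ds_meas.
rewrite (_ : [set w | _] = set0)//; apply/seteqP; split => // w /= wk.
by apply: nk; exists (map cell (pts w)).
Qed.

Let F_meas (F : seq I -> R) : measurable_fun setT (fun w => F (map cell (pts w))).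
Proof.
pose F' k := F (odflt [::] (unpickle k)).
have -> : (fun w => F (map cell (pts w))) = F' \o code.
  by apply/funext => w; rewrite /= /F' /code pickleK.
by apply: measurableT_comp => //; exact: countable_valued_measurable.
Qed.

Let psi_ge0 s : 0 <= psi s.
Proof.
apply: sumr_ge0 => c _; apply: mulr_ge0.
  by apply: addr_ge0 => //; apply: sumr_ge0.
by apply: prodr_ge0 => c' _; rewrite subr_ge0; case/andP: (v01 c c').
Qed.

Lemma WE_le_expectation : (P [set w | WE pts conn removed w <> 0%N] <=
  \int[P]_w (psi (map cell (pts w)))%:E)%E.
Proof.
pose psi' k := psi (odflt [::] (unpickle k)).
have -> : (fun w => (psi (map cell (pts w)))%:E) =
    (fun w => (psi' (code w))%:E * 1)%E.
  by apply/funext => w; rewrite mule1 /psi' /code pickleK.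
rewrite (@integral_fibers _ _ _ P code psi' (cst 1%E))//; last first.
  by move=> k; exact: psi_ge0.
rewrite (sum_fibers P code_meas measurable_WE_neq0).
apply: lee_nneseries => [k _ _|k _ /=]; first exact: measure_ge0.
under eq_integral do rewrite mule1.
rewrite integral_indic// setIT.
have [[s <-]|nk] := pselect (exists s : seq I, pickle s = k); last first.
  rewrite (_ : [set w | code w = k] = set0).
    by rewrite setI0 !measure0 mule0.
  apply/seteqP; split => // w /= wk.
  by apply: nk; exists (map cell (pts w)).
by rewrite code_fiber /psi' pickleK /=; exact: WE_cells_bound.
Qed.

Let N (c : I) (w : T) : nat := count_mem c (map cell (pts w)).

Let N_npoints c w : N c w = npoints pts (unit_square `&` cell @^-1` [set c]) w.
Proof.
rewrite /N /npoints count_map; apply: eq_in_count => x xw /=.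
have Ax := pts_sub xw.
apply/eqP/idP => [cx|]; first by rewrite mem_set.
by rewrite inE => -[].
Qed.

Let N_meas c k : measurable [set w | N c w = k].
Proof.
pose F (s : seq I) : R := (count_mem c s)%:R.
rewrite (_ : [set w | _] = (fun w => F (map cell (pts w))) @^-1` [set k%:R]).
  by rewrite -[X in measurable X]setTI; apply: F_meas.
apply/seteqP; split => w /=; rewrite /N /F; first by move=> ->.
by move/eqP; rewrite eqr_nat => /eqP.
Qed.

Let N_law c k : P [set w | N c w = k] = poisson_prob lam k [set k].
Proof.
rewrite -(cell_lam c) -(pp_poisson (bc_nodes bc))//; congr (P _).
by apply/seteqP; split => w /=; rewrite N_npoints.
Qed.

(** A count that occurs as a factor has base [t c = 1], so each cell contributes either a mean or a
    generating function and no mixed moment appears. This is the purpose of letting [v] vanish on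
    the diagonal and on far cells. *)
Let moment (Q : pred I) (t : I -> R) : (forall c, 0 <= t c) ->
  (forall c, Q c -> t c = 1) ->
  (\int[P]_w (\prod_c ((if Q c then (N c w)%:R else 1) * t c ^+ N c w))%:E =
   (\prod_c ((if Q c then lam else 1) * expR (- (lam * (1 - t c)))))%:E)%E.
Proof.
move=> t0 tQ.
pose f (i : 'I_#|I|) (k : nat) : R :=
  (if Q (enum_val i) then k%:R else 1) * t (enum_val i) ^+ k.
have reindexI (F : I -> R) : \prod_c F c = \prod_(i < #|I|) F (enum_val i).
  rewrite (reindex (fun i : 'I_#|I| => enum_val i))//.
  by apply: onW_bij; exact: enum_val_bij.
under eq_integral do rewrite reindexI.
rewrite [X in _ = X%:E]reindexI.
rewrite (@expectation_prod_indep _ _ _ P _ (fun i w => N (enum_val i) w) _ _ f).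
- rewrite -prodEFin; apply: eq_bigr => i _; rewrite /f.
  case: ifP => Qi; last first.
    under eq_integral do rewrite mul1r.
    by rewrite mul1r (poisson_pgf lam_gt0 (N_meas _) (N_law _)).
  under eq_integral do rewrite tQ// expr1n mulr1.
  by rewrite (poisson_mean lam_gt0 (N_meas _) (N_law _)) tQ// subrr mulr0 oppr0 expR0 mulr1.
- by move=> i k; exact: N_meas.
- move=> K; pose B (i : 'I_#|I|) := unit_square `&` cell @^-1` [set enum_val i].
  have KE i : [set w | K i (N (enum_val i) w)] = [set w | K i (npoints pts (B i) w)].
    by apply/seteqP; split => w /=; rewrite N_npoints.
  under eq_bigcapr do rewrite KE.
  under eq_bigr do rewrite KE.
  apply: (pp_indep (bc_nodes bc)).
    by move=> i; split; [exact: cell_meas|move=> x []].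
  by move=> i j _ _ [x [[_ /= xi] [_ /= xj]]]; apply: enum_val_inj; rewrite -xi -xj.
- by move=> i k; rewrite /f mulr_ge0 ?exprn_ge0//; case: ifP.
Qed.

Lemma WE_bound : (P [set w | WE pts conn removed w <> 0%N] <=
  (\sum_c lam * expR (- (lam * \sum_c' v c c')) *
     ((bd c)%:R + lam * \sum_c' u c c'))%:E)%E.
Proof.
apply: (le_trans WE_le_expectation).
pose M (c : I) (Q : pred I) w : R :=
  \prod_c'' ((if Q c'' then (N c'' w)%:R else 1) * (1 - v c c'') ^+ N c'' w).
have sum_count (F : I -> R) (s : seq I) :
    \sum_(c <- s) F c = \sum_c (count_mem c s)%:R * F c.
  elim: s => [|c s IH]; first by rewrite big_nil big1// => c _; rewrite mul0r.
  rewrite big_cons IH /= (bigD1 c)//= [in RHS](bigD1 c)//= eqxx.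
  rewrite natrD mulrDl mul1r -!addrA; congr (_ + (_ + _)).
  by apply: eq_bigr => c'; rewrite eq_sym => /negPf ->; rewrite add0n.
have prod_count (F : I -> R) (s : seq I) :
    \prod_(c <- s) F c = \prod_c F c ^+ (count_mem c s).
  elim: s => [|c s IH]; first by rewrite big_nil big1// => c _; rewrite expr0.
  rewrite big_cons IH /= (bigD1 c)//= [in RHS](bigD1 c)//= eqxx.
  rewrite exprD expr1 -!mulrA; congr (_ * (_ * _)).
  by apply: eq_bigr => c'; rewrite eq_sym => /negPf ->; rewrite add0n.
have M_split c (Q : pred I) w :
    M c Q w = \prod_(c' | Q c') (N c' w)%:R * \prod_c' (1 - v c c') ^+ N c' w.
  by rewrite /M big_split /= -big_mkcond.
have prod_pred2 (F : I -> R) c c' : c' != c ->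
    \prod_(i | pred2 c c' i) F i = F c * F c'.
  move=> cc'; rewrite (bigD1 c) /= ?eqxx// (bigD1 c') /=; last by rewrite eqxx orbT.
  rewrite big1 ?mulr1// => i /andP[/andP[/orP[/eqP ->|/eqP ->]]]; rewrite ?eqxx//.
(* Sums over nodes become sums over cells weighted by counts: a node in a boundary cell gives one
   count, a node with a far neighbour the product of two. *)
have psiE w : (psi (map cell (pts w)))%:E =
    (\sum_c ((bd c)%:R%:E * (M c (pred1 c) w)%:E +
       \sum_c' (u c c')%:E * (M c (pred2 c c') w)%:E))%E.
  rewrite /psi sum_count -sumEFin; apply: eq_bigr => c _.
  under [in RHS]eq_bigr do rewrite -EFinM.
  rewrite sumEFin -EFinM -EFinD sum_count prod_count.
  rewrite M_split big_pred1_eq mulrDl mulrDr; congr (_ + _)%:E.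
    by rewrite -/(N c w); ring.
  rewrite mulr_suml mulr_sumr; apply: eq_bigr => c' _; rewrite M_split.
  (* The square of a count does not occur, since [u] vanishes on near cells and in particular on the
     diagonal. *)
  have [->|cc'] := eqVneq c' c; first by rewrite u_near// !(mul0r, mulr0).
  rewrite prod_pred2// -/(N c w) -/(N c' w); ring.
have M_ge0 c Q w : (0 <= (M c Q w)%:E)%E.
  rewrite lee_fin; apply: prodr_ge0 => c' _; apply: mulr_ge0; first by case: ifP.
  by apply: exprn_ge0; rewrite subr_ge0; case/andP: (v01 c c').
have M_meas c (Q : pred I) : measurable_fun setT (fun w => (M c Q w)%:E).
  apply/measurable_EFinP.
  exact: (F_meas (fun s => \prod_c'' ((if Q c'' then (count_mem c'' s)%:R else 1) *
    (1 - v c c'') ^+ count_mem c'' s))).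
have uM_meas c c' : measurable_fun setT (fun w => (u c c')%:E * (M c (pred2 c c') w)%:E)%E.
  by apply: measurable_funeM.
have uM_ge0 c c' w : (0 <= (u c c')%:E * (M c (pred2 c c') w)%:E)%E.
  by apply: mule_ge0; [rewrite lee_fin|exact: M_ge0].
have bM_ge0 c w : (0 <= (bd c)%:R%:E * (M c (pred1 c) w)%:E)%E.
  by apply: mule_ge0; [rewrite lee_fin|exact: M_ge0].
under eq_integral do rewrite psiE.
rewrite ge0_integral_sum//; last 2 first.
- move=> c; apply: emeasurable_funD; first by apply: measurable_funeM.
  exact: emeasurable_sum.
- by move=> c w _; apply: adde_ge0 => //; apply: sume_ge0.
rewrite -sumEFin; apply: lee_sum => c _.
rewrite ge0_integralD//; last 3 first.
- by apply: measurable_funeM.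
- by move=> w _; apply: sume_ge0.
- exact: emeasurable_sum.
have v1 c' : 0 <= 1 - v c c' by rewrite subr_ge0; case/andP: (v01 c c').
have expE : \prod_c' expR (- (lam * (1 - (1 - v c c')))) =
    expR (- (lam * \sum_c' v c c')).
  rewrite -expR_sum; congr expR; rewrite mulr_sumr -sumrN.
  by apply: eq_bigr => c' _; rewrite opprB addrC subrK.
rewrite ge0_integralZl//.
rewrite moment//; last by move=> c' /eqP ->; rewrite v_diag subr0.
rewrite ge0_integral_sum//.
have term c' : (\int[P]_w ((u c c')%:E * (M c (pred2 c c') w)%:E) =
    (u c c' * (lam * lam * expR (- (lam * \sum_c'' v c c''))))%:E)%E.
  rewrite ge0_integralZl ?lee_fin//.
  have [near_cc'|far_cc'] := boolP (near c c'); first by rewrite u_near// mul0e mul0r.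
  have cc' : c' != c by apply: contraNneq far_cc' => ->; exact: near_refl.
  rewrite moment//.
    rewrite big_split /= -big_mkcond expE EFinM; congr (_ * (_ * _)%:E)%E.
    exact: prod_pred2.
  by move=> c'' /orP[/eqP ->|/eqP ->]; rewrite (v_diag, v_far)// subr0.
rewrite (eq_bigr _ (fun c' _ => term c')).
rewrite sumEFin -EFinM -EFinD lee_fin big_split /= -big_mkcond big_pred1_eq expE.
rewrite -mulr_suml; move: (\sum_c' u c c') (expR _) => U e.
by rewrite le_eqVlt; apply/orP; left; apply/eqP; ring.
Qed.

End boundary_bound.

(** * The square grid *)
Definition dn (a b : nat) : nat := (a - b + (b - a))%N.

Lemma dnC a b : dn a b = dn b a.
Proof. by rewrite /dn addnC. Qed.

Lemma leq_dn n (a b : 'I_n.+1) : (dn a b <= n.+1)%N.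
Proof. by have := ltn_ord a; have := ltn_ord b; rewrite /dn; lia. Qed.

Section grid.
Context {R : realType}.
Variable n : nat.
Let N := n.+1.
Implicit Types (t : R) (x y : R * R).

(** On [[-1/2, 1/2)] the truncation is less than [N] and [inord] is a mere cast; the values
    elsewhere are irrelevant. *)
Definition grid_coord t : 'I_N := inord (Num.truncn (N%:R * (t + 2^-1))).

Definition grid_cell x : 'I_N * 'I_N := (grid_coord x.1, grid_coord x.2).

Let N_gt0 : 0 < N%:R :> R. Proof. by rewrite ltr0n. Qed.

Lemma grid_coordP t (a : 'I_N) : - 2^-1 <= t < 2^-1 ->
  (grid_coord t = a) <-> (- 2^-1 + a%:R / N%:R <= t < - 2^-1 + a.+1%:R / N%:R).
Proof.
move=> /andP[t1 t2].
have t0 : 0 <= N%:R * (t + 2^-1) by apply: mulr_ge0; [exact: ltW|lra].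
have tN : (Num.truncn (N%:R * (t + 2^-1)) < N)%N.
  by rewrite truncn_lt_nat// -ltr_pdivlMl// mulVf ?gt_eqF//; lra.
rewrite -(rwP andP); split.
  move=> ta; have {}ta : Num.truncn (N%:R * (t + 2^-1)) = a.
    by rewrite -ta /grid_coord inordK.
  have /andP[] := truncn_itv t0; rewrite ta.
  rewrite -ler_pdivrMl// -ltr_pdivlMl// [_^-1 * _]mulrC [N%:R^-1 * _]mulrC.
  by split; lra.
move=> [h1 h2]; apply: val_inj; rewrite /= inordK//.
apply/eqP; rewrite truncn_eq//; apply/andP; split.
  by rewrite -ler_pdivrMl// [_^-1 * _]mulrC; lra.
by rewrite -ltr_pdivlMl// [_^-1 * _]mulrC; lra.
Qed.

Definition grid_itv (a : 'I_N) : set R :=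
  `[- 2^-1 + a%:R / N%:R, - 2^-1 + a.+1%:R / N%:R[%classic.

Lemma grid_cell_preimage c :
  unit_square `&` grid_cell @^-1` [set c] = grid_itv c.1 `*` grid_itv c.2.
Proof.
have sub (a : 'I_N) t : - 2^-1 + a%:R / N%:R <= t < - 2^-1 + a.+1%:R / N%:R ->
    - 2^-1 <= t < 2^-1.
  have a0 : 0 <= a%:R / N%:R :> R by rewrite divr_ge0.
  have a1 : a.+1%:R / N%:R <= 1 :> R by rewrite ler_pdivrMr// mul1r ler_nat.
  by lra.
case: c => a b; apply/seteqP; split => [[x y]|[x y]] /=; rewrite /grid_itv /= !in_itv /=.
  by move=> [[x1 y1] [/(grid_coordP _ x1) ? /(grid_coordP _ y1) ?]].
move=> [xa yb]; have x1 := sub _ _ xa; have y1 := sub _ _ yb.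
split; first by split.
by rewrite /grid_cell /=; congr (_, _); apply/grid_coordP.
Qed.

Lemma measurable_grid_cell c :
  measurable (unit_square `&` grid_cell @^-1` [set c]).
Proof.
by rewrite grid_cell_preimage; apply: measurableX; exact: measurable_itv.
Qed.

Lemma area_grid_cell c :
  fine (area (unit_square `&` grid_cell @^-1` [set c])) = (N%:R ^+ 2)^-1 :> R.
Proof.
have len (a : 'I_N) : lebesgue_measure (grid_itv a) = (N%:R^-1)%:E :> \bar R.
  rewrite /grid_itv lebesgue_measure_itv /= lte_fin ifT.
    rewrite -EFinB; congr EFin; rewrite -natr1; field.
    by rewrite gt_eqF.
  by rewrite ltrD2l ltr_pM2r ?invr_gt0// ltr_nat.
rewrite grid_cell_preimage /area product_measure1E; [|exact: measurable_itv..].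
by rewrite [X in fine (X * _)%E]len [X in fine (_ * X)%E]len /= expr2 invfM.
Qed.

Lemma grid_coord_dist t t' : - 2^-1 <= t < 2^-1 -> - 2^-1 <= t' < 2^-1 ->
  (dn (grid_coord t) (grid_coord t'))%:R - 1 <= `|t - t'| * N%:R
    <= (dn (grid_coord t) (grid_coord t'))%:R + 1.
Proof.
move=> tA tA'; have /(grid_coordP _ tA) := erefl (grid_coord t).
have /(grid_coordP _ tA') := erefl (grid_coord t').
move: (grid_coord t) (grid_coord t') => a b.
have dnE : (dn a b)%:R = `|a%:R - b%:R| :> R.
  rewrite /dn; case: (leqP a b) => ab.
    by rewrite (eqP ab) add0n natrB// distrC ger0_norm// subr_ge0 ler_nat.
  by rewrite (eqP (ltnW ab)) addn0 natrB ?(ltnW ab)// ger0_norm// subr_ge0 ler_nat ltnW.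
rewrite dnE => /andP[h1 h2] /andP[h3 h4].
have e1 : (- 2^-1 + a%:R / N%:R) * N%:R <= t * N%:R by rewrite ler_pM2r.
have e2 : t * N%:R < (- 2^-1 + a.+1%:R / N%:R) * N%:R by rewrite ltr_pM2r.
have e3 : (- 2^-1 + b%:R / N%:R) * N%:R <= t' * N%:R by rewrite ler_pM2r.
have e4 : t' * N%:R < (- 2^-1 + b.+1%:R / N%:R) * N%:R by rewrite ltr_pM2r.
move: e1 e2 e3 e4; rewrite !mulrDl !divfK ?gt_eqF// -[a.+1%:R]natr1 -[b.+1%:R]natr1 => e1 e2 e3 e4.
have -> : `|t - t'| * N%:R = `|t * N%:R - t' * N%:R|.
  by rewrite -mulrBl normrM (gtr0_norm N_gt0).
move: (t * _) (t' * _) e1 e2 e3 e4 => x y *.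
by apply/andP; split; case: (ger0P (x - y)); case: (ger0P (a%:R - b%:R)); lra.
Qed.

End grid.

(** * Bounds on the connection probabilities between grid cells *)

Section grid_bound.
Context {R : realType}.
Variables (n m : nat) (g : R -> R) (s : R).
Let N := n.+1.
Implicit Types (c : 'I_N * 'I_N).

Definition near_cells c c' := (dn c.1 c'.1 <= m)%N && (dn c.2 c'.2 <= m)%N.

(** The number of rows of cells between row [a] and the nearer side of the square. *)
Definition depth (a : nat) := minn a (n - a).

Definition boundary_cell c := (depth c.1 < m)%N || (depth c.2 < m)%N.

(** Displacements are counted in cells; [s] stands for the number of cells per connection radius. *)
Definition profile (i j : nat) : R := g (enorm (i%:R / s, j%:R / s)).

(** Points of rows at index distance [k] differ by at most [k + 1] sides in that coordinate, whence
    the successors. Excluding [c = c'] gives the vanishing on the diagonal required of [v]. *)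
Definition near_prob c c' : R :=
  if near_cells c c' && (c != c')
  then profile (dn c.1 c'.1).+1 (dn c.2 c'.2).+1 else 0.

Definition dn_torus (a b : nat) := minn (dn a b) (N - dn a b).

(** The predecessor is the matching lower bound: at index distance [k] the coordinates differ by at
    least [k - 1] sides, and the sup norm is below the Euclidean one. Boundary cells are left out
    because a cell far from them in the square may be close on the torus. *)
Definition far_prob c c' : R :=
  if ~~ near_cells c c' && ~~ boundary_cell c
  then g ((maxn (dn_torus c.1 c'.1) (dn_torus c.2 c'.2)).-1%:R / s) else 0.

End grid_bound.

Section grid_WE_bound.
Context {R : realType} {d : measure_display} {T : measurableType d}.
Variables (P : probability T R) (g : R -> R) (r rho : R).
Variables (pts : T -> seq (R * R)) (conn removed : T -> rel nat).
Hypotheses (bc : boundary_coupling P g r rho pts conn removed)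
  (g_range : forall x : R, 0 <= x -> 0 <= g x <= 1)
  (g_noninc : forall x y : R, 0 <= x -> x <= y -> g y <= g x)
  (r_gt0 : 0 < r) (rho_gt0 : 0 < rho).
Variables (n m : nat).
Hypothesis small_m : (2 * m.+1 <= n.+1)%N.
Let s := n.+1%:R * r.
Let lam := rho / n.+1%:R ^+ 2.

Let N_gt0 : 0 < n.+1%:R :> R. Proof. by rewrite ltr0n. Qed.

Let s_gt0 : 0 < s. Proof. exact: mulr_gt0. Qed.

Lemma grid_WE_bound : (P [set w | WE pts conn removed w <> 0%N] <=
  (\sum_(c : 'I_n.+1 * 'I_n.+1)
     lam * expR (- (lam * \sum_c' near_prob m g s c c')) *
     ((boundary_cell m c)%:R + lam * \sum_c' far_prob m g s c c'))%:E)%E.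
Proof.
have g0 x : 0 <= x -> 0 <= g x by move=> /g_range/andP[].
have coords (x y : R * R) : unit_square x -> unit_square y ->
    let c := grid_cell n x in let c' := grid_cell n y in
    [/\ (dn c.1 c'.1)%:R - 1 <= `|x.1 - y.1| * n.+1%:R,
        `|x.1 - y.1| * n.+1%:R <= (dn c.1 c'.1)%:R + 1,
        (dn c.2 c'.2)%:R - 1 <= `|x.2 - y.2| * n.+1%:R &
        `|x.2 - y.2| * n.+1%:R <= (dn c.2 c'.2)%:R + 1].
  move=> [x1 x2] [y1 y2] /=.
  by have /andP[? ?] := grid_coord_dist n x1 y1; have /andP[? ?] := grid_coord_dist n x2 y2.
(* Near points differ by at most [(m + 1) / N <= 1 / 2] in each coordinate, so the shortest way does
   not wrap around. *)
have near_half (x y : R * R) : unit_square x -> unit_square y ->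
    near_cells m (grid_cell n x) (grid_cell n y) ->
    `|x.1 - y.1| <= 2^-1 /\ `|x.2 - y.2| <= 2^-1.
  move=> xA yA /andP[d1 d2]; have [_ h1 _ h2] := coords x y xA yA.
  have half (k : nat) (t : R) : (k <= m)%N -> t * n.+1%:R <= k%:R + 1 -> t <= 2^-1.
    move=> km tk; rewrite -(ler_pM2r N_gt0); apply: (le_trans tk).
    have : (2 * k.+1)%:R <= n.+1%:R :> R by rewrite ler_nat; lia.
    by rewrite natrM -[k.+1%:R]natr1; lra.
  by split; [apply: half d1 h1|apply: half d2 h2].
apply: (@WE_bound _ _ _ P g r rho pts conn removed bc g_range g_noninc r_gt0
  _ (@grid_cell R n) (near_cells m) (boundary_cell m)) => //.
- by move=> c; exact: measurable_grid_cell.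
- by move=> c; rewrite /near_cells /dn !subnn.
- by move=> c c'; rewrite /near_cells (dnC c.1) (dnC c.2).
- by move=> x y xA yA /(near_half _ _ xA yA)[? ?]; exact: tdist_edist.
- move=> c c'; rewrite /near_prob; case: ifP => _; last by rewrite lexx ler01.
  by apply: g_range; exact: enorm_ge0.
- by move=> c; rewrite /near_prob eqxx andbF.
- by move=> c c' /negPf nc; rewrite /near_prob nc.
- move=> x y xA yA; rewrite /near_prob; case: ifP => [/andP[nc _]|_]; last first.
    by apply: g0; rewrite divr_ge0 ?tdist_ge0// ltW.
  have [xy1 xy2] := near_half x y xA yA nc.
  have [_ h1 _ h2] := coords x y xA yA.
  rewrite tdist_edist//; apply: g_noninc; first by rewrite divr_ge0 ?enorm_ge0// ltW.
  rewrite /Defs.edist -enormZ; last by rewrite invr_ge0 ltW.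
  have bnd (k : nat) (t : R) : `|t| * n.+1%:R <= k%:R + 1 ->
      `|t / r| <= `|k.+1%:R / s|.
    rewrite natr1 !normrM (ger0_norm (ler0n _ _)).
    rewrite [`|r^-1|]gtr0_norm ?invr_gt0// [`|s^-1|]gtr0_norm ?invr_gt0// /s.
    by rewrite invfM mulrA -ler_pdivlMr// => h; rewrite ler_pM2r ?invr_gt0.
  by apply: ler_enorm; [exact: bnd h1|exact: bnd h2].
- by move=> c c'; rewrite /far_prob; case: ifP => // _; apply: g0; rewrite divr_ge0// ltW.
- by move=> c c' nc; rewrite /far_prob nc.
- move=> x y xA yA nbd far; rewrite /far_prob far nbd.
  have [h1 h1' h2 h2'] := coords x y xA yA.
  have [u1 u2] := unit_square_diff xA yA.
  set c := grid_cell n x in h1 h1' h2 h2' *; set c' := grid_cell n y in h1 h1' h2 h2' *.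
  apply: g_noninc; first by rewrite divr_ge0// ltW.
  rewrite /s invfM mulrA ler_pM2r ?invr_gt0// ler_pdivrMr//.
  have circ (k : nat) (t : R) : (k <= n.+1)%N -> k%:R - 1 <= `|t| * n.+1%:R ->
      `|t| * n.+1%:R <= k%:R + 1 ->
      (minn k (n.+1 - k))%:R - 1 <= circle_norm t * n.+1%:R.
    move=> kN t1 t2; rewrite /circle_norm /Num.min; case: ltP => _.
      by apply: le_trans t1; rewrite lerD2r ler_nat geq_minl.
    rewrite mulrBl mul1r; apply: (@le_trans _ _ ((n.+1 - k)%:R - 1)).
      by rewrite lerD2r ler_nat geq_minr.
    by rewrite natrB//; lra.
  have t1 := circ _ _ (leq_dn c.1 c'.1) h1 h1'.
  have t2 := circ _ _ (leq_dn c.2 c'.2) h2 h2'.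
  have t1' := circle_norm_le_tdist1 xA yA; have t2' := circle_norm_le_tdist2 xA yA.
  rewrite -(ler_pM2r N_gt0) in t1'; rewrite -(ler_pM2r N_gt0) in t2'.
  have pos : 0 <= tdist x y * n.+1%:R by rewrite mulr_ge0 ?tdist_ge0// ltW.
  have pred_le (k : nat) (t : R) : 0 <= t -> k%:R - 1 <= t -> k.-1%:R <= t.
    by case: k => // k t0; rewrite -natr1 addrK.
  apply: pred_le => //; rewrite /maxn; case: ifP => _.
    exact: le_trans t2 t2'.
  exact: le_trans t1 t1'.
- by rewrite divr_gt0// exprn_gt0.
- by move=> c; rewrite area_grid_cell.
Qed.

End grid_WE_bound.

(** * Counting cells by their index distance *)

Section sums_over_fibers.
Context {R : realType}.

Lemma card_le_size n (A : pred 'I_n) (l : seq nat) :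
  (forall a, A a -> val a \in l) -> (#|A| <= size l)%N.
Proof.
move=> Al; rewrite cardE -(size_map val); apply: uniq_leq_size.
  by rewrite map_inj_uniq ?enum_uniq//; exact: val_inj.
by move=> _ /mapP[a + ->]; rewrite mem_enum; exact: Al.
Qed.

Lemma sum_comp_le n (M k : nat) (Q : pred 'I_n) (phi : 'I_n -> nat)
    (f : nat -> R) : (forall i, 0 <= f i) ->
  (forall a, Q a -> (phi a < M)%N) ->
  (forall i, (#|[pred a | phi a == i]| <= k)%N) ->
  \sum_(a | Q a) f (phi a) <= k%:R * \sum_(i < M) f i.
Proof.
move=> f0 phiM cardk.
have -> : \sum_(a | Q a) f (phi a) =
    \sum_(i < M) \sum_(a | Q a && (phi a == i)) f i.
  rewrite (exchange_big_dep Q) /=; last by move=> i a _ /andP[].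
  apply: eq_bigr => a Qa; rewrite (bigD1 (Ordinal (phiM a Qa)))/= ?Qa ?eqxx//.
  rewrite big1 ?addr0// => i /andP[/andP[_ /eqP pi]].
  by move=> /negP[]; apply/eqP/val_inj.
rewrite mulr_sumr; apply: ler_sum => i _.
rewrite sumr_const [leRHS]mulr_natl; apply: ler_wpMn2l => //.
apply: leq_trans (cardk i); apply: subset_leq_card; apply/fintype.subsetP => a.
by rewrite !inE => /andP[].
Qed.

(** Each distance from 1 to [m] is attained on at least one side of [a], since [m] is less than half
    of the row, and on both sides up to [depth n a]. *)
Lemma sum_dn_ge n m p (a : 'I_n.+1) (f : nat -> R) :
  (forall i, 0 <= f i) -> (2 * m.+1 <= n.+1)%N -> (p <= m)%N ->
  (p <= depth n a)%N ->
  \sum_(i < m) f i.+1 + \sum_(i < p) f i.+1 <=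
  \sum_(a' : 'I_n.+1 | (0 < dn a a' <= m)%N) f (dn a a').
Proof.
move=> f0 mn pm pa.
have -> : \sum_(a' : 'I_n.+1 | (0 < dn a a' <= m)%N) f (dn a a') =
    \sum_(i < m) \sum_(a' : 'I_n.+1 | dn a a' == i.+1) f i.+1.
  rewrite [RHS](exchange_big_dep (fun a' : 'I_n.+1 => (0 < dn a a' <= m)%N)) /=.
    apply: eq_bigr => a'; case E : (dn a a') => [//|k] /= km.
    rewrite (bigD1 (Ordinal km))//= big1 ?addr0// => i /andP[/eqP[ki]].
    by move=> /negP[]; apply/eqP/val_inj.
  by move=> i a' _ /eqP ->; rewrite ltn_ord.
have -> : \sum_(i < p) f i.+1 = \sum_(i < m) (if (i < p)%N then f i.+1 else 0).
  by rewrite -big_mkcond (big_ord_widen_cond _ xpredT (fun i => f i.+1) pm).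
rewrite -big_split /=; apply: ler_sum => i _; rewrite sumr_const.
have im := ltn_ord i; have an := ltn_ord a.
have right (h : (a + i.+1 < n.+1)%N) : dn a (Ordinal h) = i.+1.
  by rewrite /dn /=; lia.
have lh : (a - i.+1 < n.+1)%N by lia.
have left : (i < a)%N -> dn a (Ordinal lh) = i.+1 by rewrite /dn /=; lia.
case: ifP => ip.
  have h : (a + i.+1 < n.+1)%N by move: pa; rewrite /depth; lia.
  have ia : (i < a)%N by move: pa; rewrite /depth; lia.
  rewrite -mulr2n; apply: ler_wpMn2l => //.
  apply: (@leq_trans #|[set Ordinal h; Ordinal lh]%SET|).
    by rewrite cards2 -val_eqE /=; case: eqP => //; lia.
  apply: subset_leq_card; apply/fintype.subsetP => x; rewrite !inE => /orP[]/eqP ->.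
    by rewrite unfold_in; apply/eqP; exact: right.
  by rewrite unfold_in; apply/eqP; exact: left.
rewrite addr0 -[X in X <= _]mulr1n; apply: ler_wpMn2l => //.
apply/card_gt0P; have [ia|ai] := ltnP i a.
  by exists (Ordinal lh); rewrite unfold_in; apply/eqP; exact: left.
have h : (a + i.+1 < n.+1)%N by lia.
by exists (Ordinal h); by rewrite unfold_in; apply/eqP; exact: right.
Qed.

End sums_over_fibers.

Lemma sum_pair {R : realType} (I J : finType) (F : I * J -> R) :
  \sum_c F c = \sum_a \sum_b F (a, b).
Proof. by rewrite pair_bigA; apply: eq_bigr => -[a b] _. Qed.

Lemma dn_torus_fiber n a b i : (a < n.+1)%N -> (b < n.+1)%N ->
  dn_torus n a b = i ->
  [|| b == (a + i)%N, b == (a - i)%N, b == (a + (n.+1 - i))%N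
    | b == (a + i - n.+1)%N].
Proof. by rewrite /dn_torus /dn; lia. Qed.

Lemma depth_fiber n a i : (a < n.+1)%N -> depth n a = i ->
  (a == i) || (a == (n - i)%N).
Proof. by rewrite /depth; lia. Qed.

Lemma far_dn_torus n m a b a' b' : (a < n.+1)%N -> (b < n.+1)%N ->
  (a' < n.+1)%N -> (b' < n.+1)%N -> (2 * m.+1 <= n.+1)%N ->
  ~~ ((depth n a < m) || (depth n b < m))%N ->
  ~~ ((dn a a' <= m) && (dn b b' <= m))%N ->
  (m < maxn (dn_torus n a a') (dn_torus n b b'))%N.
Proof. by rewrite /depth /dn_torus /dn; lia. Qed.

Section grid_sums.
Context {R : realType}.
Variables (n m : nat) (g : R -> R) (s : R).
Hypotheses (g_range : forall x : R, 0 <= x -> 0 <= g x <= 1)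
  (g_noninc : forall x y : R, 0 <= x -> x <= y -> g y <= g x)
  (s_gt0 : 0 < s) (mn : (2 * m.+1 <= n.+1)%N).
Let N := n.+1.
Let H := profile g s.
Let h (l : nat) := g (l%:R / s).
Let K (i j : nat) := H i.+2 j.+2.
Implicit Types c : 'I_N * 'I_N.

Let H_ge0 i j : 0 <= H i j.
Proof. by have /andP[] := g_range (enorm_ge0 (i%:R / s, j%:R / s)). Qed.

Let h_ge0 l : 0 <= h l.
Proof. by have /andP[] : 0 <= h l <= 1 by apply: g_range; rewrite divr_ge0 ?(ltW s_gt0). Qed.

Let H_le1 i j : H i j <= 1.
Proof. by have /andP[] := g_range (enorm_ge0 (i%:R / s, j%:R / s)). Qed.

Lemma profileC i j : H i j = H j i.
Proof. by rewrite /H /profile enorm_swap. Qed.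

Lemma profile_le_max i j : H i j <= h (maxn i j).
Proof.
apply: g_noninc; first by rewrite divr_ge0 ?(ltW s_gt0).
have pos k : 0 <= k%:R / s by rewrite divr_ge0 ?(ltW s_gt0).
rewrite /maxn; case: ifP => _.
  by apply: le_trans (le_enorm2 _) => /=; rewrite ger0_norm.
by apply: le_trans (le_enorm1 _) => /=; rewrite ger0_norm.
Qed.

(** One double sum for each quadrant seen from [c], cut at [p] and [q] towards the nearer sides. The
    row and the column of [c] are discarded; at index distance [i + 1] the profile is taken at
    [i + 2], whence the shift in [K]. *)
Lemma near_sum_ge c p q : (p <= m)%N -> (p <= depth n c.1)%N ->
  (q <= m)%N -> (q <= depth n c.2)%N ->
  \sum_(i < m) (\sum_(j < m) K i j + \sum_(j < q) K i j) +
  \sum_(i < p) (\sum_(j < m) K i j + \sum_(j < q) K i j) <=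
  \sum_c' near_prob m g s c c'.
Proof.
move=> pm pc qm qc.
pose F i := \sum_(j < m) H i.+1 j.+2 + \sum_(j < q) H i.+1 j.+2.
have F0 i : 0 <= F i by apply: addr_ge0; apply: sumr_ge0.
apply: le_trans (sum_dn_ge F0 mn pm pc) _.
rewrite sum_pair big_mkcond /=; apply: ler_sum => a _.
have near0 b : 0 <= near_prob m g s c (a, b).
  by rewrite /near_prob; case: ifP => // _; exact: H_ge0.
case: ifP => [/andP[a0 am]|_]; last exact: sumr_ge0.
apply: le_trans (sum_dn_ge (fun j => H_ge0 (dn c.1 a).+1 j.+1) mn qm qc) _.
rewrite big_mkcond; apply: ler_sum => b _; case: ifP => // /andP[b0 bm].
rewrite /near_prob /near_cells /= am bm /= ifT//.
by apply/eqP => cab; move: a0; rewrite cab /= /dn subnn.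
Qed.

(** Away from the boundary a far cell is also more than [m] cells away on the torus. A torus
    distance is attained at most four times in each coordinate, whence 16. *)
Lemma far_sum_le c : ~~ boundary_cell m c ->
  \sum_c' far_prob m g s c c' <=
  16 * \sum_(i < N.+1) \sum_(j < N.+1)
    (if (m < maxn i j)%N then h (maxn i j).-1 else 0).
Proof.
move=> nbd.
pose f i j : R := if (m < maxn i j)%N then h (maxn i j).-1 else 0.
have f0 i j : 0 <= f i j by rewrite /f; case: ifP.
have fib (a : 'I_N) i : (#|[pred b : 'I_N | dn_torus n a b == i]| <= 4)%N.
  apply: (@card_le_size _ _ [:: (a + i)%N; (a - i)%N; (a + (N - i))%N; (a + i - N)%N]).
  move=> b /eqP; rewrite !inE; apply: dn_torus_fiber; exact: ltn_ord.
have dnN (a b : 'I_N) : (dn_torus n a b < N.+1)%N.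
  by rewrite ltnS /dn_torus geq_min leq_dn.
apply: (@le_trans _ _ (\sum_(a : 'I_N) \sum_(b : 'I_N)
    f (dn_torus n c.1 a) (dn_torus n c.2 b))).
  rewrite sum_pair; apply: ler_sum => a _; apply: ler_sum => b _.
  rewrite /far_prob; case: ifP => [/andP[far _]|_]; last exact: f0.
  rewrite /f ifT//; apply: (far_dn_torus _ _ _ _ mn) nbd far; exact: ltn_ord.
apply: (@le_trans _ _ (\sum_(a : 'I_N) 4 * \sum_(j < N.+1)
    f (dn_torus n c.1 a) j)).
  apply: ler_sum => a _.
  exact: (sum_comp_le (k := 4) (f0 _) (fun b _ => dnN c.2 b) (fib c.2)).
rewrite -mulr_sumr (_ : 16 = 4 * 4 :> R); last by ring.
rewrite -mulrA ler_pM2l//.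
apply: (sum_comp_le (k := 4) _ (fun b _ => dnN c.1 b) (fib c.1) (f := fun i => \sum_(j < N.+1) f i j)).
by move=> i; exact: sumr_ge0.
Qed.

(** There are [2 * l + 1] index pairs with maximum [l]. *)
Lemma square_shells (f : nat -> R) M :
  \sum_(i < M) \sum_(j < M) f (maxn i j) = \sum_(l < M) (2 * l + 1)%:R * f l.
Proof.
elim: M => [|M IH]; first by rewrite !big_ord0.
rewrite big_ord_recr [RHS]big_ord_recr /= -IH.
under eq_bigr => i _.
  rewrite big_ord_recr /= (maxn_idPr (ltnW (ltn_ord i))); over.
rewrite big_split /= sumr_const card_ord -addrA; congr (_ + _).
rewrite big_ord_recr /= maxnn.
under eq_bigr => i _ do rewrite (maxn_idPl (ltnW (ltn_ord i))).
rewrite sumr_const card_ord -mulr_natl natrD natrM; ring.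
Qed.

End grid_sums.

(** * Comparison of grid sums with the integral of [g] *)

Section riemann_sum.
Context {R : realType}.
Variables (g : R -> R) (s C : R).
Hypotheses (g_range : forall x : R, 0 <= x -> 0 <= g x <= 1)
  (g_noninc : forall x y : R, 0 <= x -> x <= y -> g y <= g x)
  (C_def : (\int[(lebesgue_measure \x lebesgue_measure)%E]_x
              (g (enorm x))%:E)%E = C%:E)
  (s_gt0 : 0 < s).

Let mu2 := (@lebesgue_measure R \x @lebesgue_measure R)%E.

Let H_ge0 i j : 0 <= profile g s i j.
Proof. by have /andP[] := g_range (enorm_ge0 (i%:R / s, j%:R / s)). Qed.

Let strip (i : nat) : set R :=
  `[i%:R / s, i.+1%:R / s]%classic `|` `[- (i.+1%:R / s), - (i%:R / s)]%classic.

Let strip_meas i : measurable (strip i).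
Proof. by apply: measurableU; exact: measurable_itv. Qed.

Let strip_measure i : (lebesgue_measure (strip i) <= (2 / s)%:E)%E.
Proof.
apply: le_trans (measureU2 _ _ _) _; [exact: measurable_itv..|].
have lt : i%:R / s < i.+1%:R / s by rewrite ltr_pM2r ?invr_gt0// ltr_nat.
rewrite [X in (X + _)%E]lebesgue_measure_itv [X in (_ + X)%E]lebesgue_measure_itv /=.
rewrite !lte_fin ltrN2 lt -!EFinB -EFinD lee_fin -natr1.
by rewrite le_eqVlt; apply/orP; left; apply/eqP; field; rewrite gt_eqF.
Qed.

Let box (M : nat) : set (R * R) :=
  [set x | `|x.1| * s < M%:R /\ `|x.2| * s < M%:R].

Let box_meas M : measurable (box M).
Proof.
have b1 : measurable_fun setT (fun x : R * R => `|x.1| * s).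
  by apply: measurable_funM => //; apply: measurableT_comp => //; exact: normr_measurable.
have b2 : measurable_fun setT (fun x : R * R => `|x.2| * s).
  by apply: measurable_funM => //; apply: measurableT_comp => //; exact: normr_measurable.
rewrite (_ : box M = ((fun x : R * R => `|x.1| * s) @^-1` `]-oo, M%:R[) `&`
  ((fun x : R * R => `|x.2| * s) @^-1` `]-oo, M%:R[)).
  apply: measurableI; rewrite -[X in measurable X]setTI.
    by apply: b1 => //; exact: measurable_itv.
  by apply: b2 => //; exact: measurable_itv.
by apply/seteqP; split => x; rewrite /box /= !in_itv.
Qed.

Let g_enorm_meas : measurable_fun setT (fun x : R * R => (g (enorm x))%:E).
Proof.
apply/measurable_EFinP; pose g' t := g (Num.max 0 t).
have mg' : measurable_fun setT g'.
  apply: nonincreasing_measurable => // x y xy; apply: g_noninc.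
    by rewrite le_max lexx.
  by rewrite ge_max le_max lexx /= le_max xy orbT.
have -> : (fun x : R * R => g (enorm x)) = (fun x => g' (enorm x)).
  by apply/funext => x; rewrite /g'; congr g; apply/esym/max_idPr/enorm_ge0.
apply: (measurableT_comp mg'); apply: (measurableT_comp measurable_sqrt).
by apply: measurable_funD; apply: measurable_funX.
Qed.

Let g_enorm_le M x : box M x -> g (enorm x) <=
  \sum_(i < M) \sum_(j < M) profile g s i j * \1_(strip i `*` strip j) x.
Proof.
have coord (t : R) : `|t| * s < M%:R -> exists2 i : 'I_M,
    i%:R / s <= `|t| & strip i t.
  move=> tM; have t0 : 0 <= `|t| * s by rewrite mulr_ge0 ?(ltW s_gt0).
  have iM : (Num.truncn (`|t| * s) < M)%N by rewrite truncn_lt_nat.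
  exists (Ordinal iM); have /andP[/= i1 i2] := truncn_itv t0.
    by rewrite ler_pdivrMr.
  move: i1 i2; rewrite -ler_pdivrMr// -ltr_pdivlMr// => i1 /ltW i2.
  have [t0'|t0'] := lerP 0 t.
    by left; rewrite /= in_itv /=; move: i1 i2; rewrite ger0_norm// => -> ->.
  right; rewrite /= in_itv /=; move: i1 i2; rewrite ltr0_norm// => i1 i2.
  by rewrite lerNl i2 lerNr i1.
case: x => x1 x2 [/= /coord[i i1 si] /coord[j j1 sj]].
rewrite (bigD1 i)//= (bigD1 j)//= indicE mem_set; last by split.
rewrite mulr1 -addrA ler_wpDr//.
  apply: addr_ge0; first by apply: sumr_ge0 => *; rewrite mulr_ge0// indicE.
  by apply: sumr_ge0 => *; apply: sumr_ge0 => *; rewrite mulr_ge0// indicE.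
have pos (k : nat) : 0 <= k%:R / s by rewrite divr_ge0 ?(ltW s_gt0).
by apply: g_noninc; [exact: enorm_ge0|apply: ler_enorm; rewrite /= ger0_norm].
Qed.

Let box_integral M : (\int[mu2]_(x in box M) (g (enorm x))%:E <=
  (4 / s ^+ 2 * \sum_(i < M) \sum_(j < M) profile g s i j)%:E)%E.
Proof.
have mQ i j : measurable (strip i `*` strip j) by exact: measurableX.
have mF i j : measurable_fun (box M)
    (fun x => (profile g s i j * \1_(strip i `*` strip j) x)%:E).
  by apply/measurable_EFinP; apply: measurable_funM.
have mFF i : measurable_fun (box M)
    (fun x => \sum_(j < M) (profile g s i j * \1_(strip i `*` strip j) x)%:E)%E.
  by apply: emeasurable_sum => j; exact: mF.
have F0 i j x : (0 <= (profile g s i j * \1_(strip i `*` strip j) x)%:E)%E.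
  by rewrite lee_fin mulr_ge0// indicE.
apply: (@le_trans _ _ (\int[mu2]_(x in box M)
  \sum_(i < M) \sum_(j < M) (profile g s i j * \1_(strip i `*` strip j) x)%:E)%E).
  apply: ge0_le_integral.
  - exact: box_meas.
  - by move=> x _; rewrite lee_fin; case/andP: (g_range (enorm_ge0 x)).
  - by apply: (@measurable_funTS _ _ (R * R)%type); exact: g_enorm_meas.
  - by apply: emeasurable_sum => i; exact: mFF.
  - move=> x /g_enorm_le gx; under eq_bigr do rewrite sumEFin.
    by rewrite sumEFin lee_fin.
rewrite ge0_integral_sum; last 3 first.
- exact: box_meas.
- by move=> i; exact: mFF.
- by move=> i x _; exact: sume_ge0.
rewrite mulr_sumr -sumEFin; apply: lee_sum => i _.
rewrite ge0_integral_sum; last 3 first.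
- exact: box_meas.
- by move=> j; exact: mF.
- by move=> j x _; exact: F0.
rewrite mulr_sumr -sumEFin; apply: lee_sum => j _.
under eq_integral do rewrite EFinM.
rewrite ge0_integralZl//; last 3 first.
- exact: box_meas.
- by apply/measurable_EFinP; apply: measurable_indic; exact: mQ.
- by rewrite lee_fin.
rewrite integral_indic; [|exact: box_meas|exact: mQ].
rewrite [_ / _ * _]mulrC EFinM lee_wpmul2l ?lee_fin//.
apply: (@le_trans _ _ (mu2 (strip i `*` strip j))).
  apply: le_measure; rewrite ?inE; [|exact: mQ|by move=> x []].
  by apply: measurableI; [exact: mQ|exact: box_meas].
rewrite /mu2 product_measure1E; [|exact: strip_meas..].
rewrite (_ : 4 / s ^+ 2 = (2 / s) * (2 / s)); last first.
  by field; rewrite gt_eqF.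
by rewrite EFinM; apply: lee_pmul => //; exact: strip_measure.
Qed.

(** On a product of strips [g] is at most its value at the corners nearest the origin. Such a
    product consists of four rectangles, of total area at most [4 / s ^+ 2]; this is where the 4
    arises. The boxes exhaust the plane, and monotone convergence concludes. Only boxes beyond [M0]
    are tested, so that the sums to be bounded may be split at a fixed index. *)
Lemma integral_le_riemann M0 B :
  (forall k, \sum_(i < M0 + k) \sum_(j < M0 + k) profile g s i j <= B) ->
  C * s ^+ 2 <= 4 * B.
Proof.
move=> QB.
have boxT : \bigcup_k box (M0 + k) = setT.
  apply/seteqP; split => // x _.
  exists (maxn (Num.truncn (`|x.1| * s)).+1 (Num.truncn (`|x.2| * s)).+1) => //.
  split; apply: lt_le_trans (truncnS_gt _) _; rewrite ler_nat.
    by apply: leq_trans (leq_maxl _ _) (leq_addl _ _).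
  by apply: leq_trans (leq_maxr _ _) (leq_addl _ _).
have nd : nondecreasing_seq (fun k => box (M0 + k)).
  move=> k l kl; apply/subsetPset => x [x1 x2].
  by split; [apply: lt_le_trans x1 _|apply: lt_le_trans x2 _];
    rewrite ler_nat leq_add2l.
have mb k : measurable (box (M0 + k)) by exact: box_meas.
have mf k : measurable_fun (box (M0 + k)) (fun x => (g (enorm x))%:E).
  exact: measurable_funTS.
have f0 k x : box (M0 + k) x -> (0 <= (g (enorm x))%:E)%E.
  by move=> _; rewrite lee_fin; case/andP: (g_range (enorm_ge0 x)).
have lim : (\int[mu2]_(x in box (M0 + k)) (g (enorm x))%:E)%E @[k --> \oo] -->
    (\int[mu2]_(x in \bigcup_k box (M0 + k)) (g (enorm x))%:E)%E.
  by apply: ge0_nondecreasing_set_cvg_integral; [exact: nd|exact: mb|exact: mf|exact: f0].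
have : (C%:E <= (4 / s ^+ 2 * B)%:E)%E.
  rewrite -C_def -boxT -(cvg_lim _ lim)//; apply: lime_le.
    by apply/cvg_ex; eexists; exact: lim.
  apply: nearW => k; apply: le_trans (box_integral _) _.
  by rewrite lee_fin ler_wpM2l// divr_ge0// exprn_ge0// ltW.
by rewrite lee_fin mulrAC ler_pdivlMr // exprn_gt0.
Qed.

End riemann_sum.

(** * Tail sums from the decay of [g] *)

Section logarithmic_tail.
Context {R : realType}.
Variables (g : R -> R) (s eta x0 : R).
Hypotheses (s_gt0 : 0 < s) (eta_ge0 : 0 <= eta)
  (g_tail : forall x, x0 <= x -> g x <= eta / (x ^+ 2 * ln x ^+ 2)).

(* The sum of 1/(l ln^2(l/s)) is compared with the telescoping sum of the
   differences of 1/ln(l/s). *)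
Lemma log_term_le (l : nat) : 1 < l%:R / s ->
  (l.+1%:R * ln (l.+1%:R / s) ^+ 2)^-1 <=
  (ln (l%:R / s))^-1 - (ln (l.+1%:R / s))^-1.
Proof.
move=> ls; have l0 : 0 < l%:R :> R.
  by move: ls; rewrite ltr_pdivlMr// mul1r; exact: lt_trans.
have l1 : 0 < l.+1%:R :> R by rewrite ltr0n.
have lnl : 0 < ln (l%:R / s) by exact: ln_gt0.
have ll : ln (l%:R / s) + l.+1%:R^-1 <= ln (l.+1%:R / s).
  have -> : l%:R / s = (l.+1%:R / s) * (1 - l.+1%:R^-1).
    by rewrite mulrBr mulr1 mulrAC mulfV ?gt_eqF// -mulrBl -natr1 addrK.
  have inv1 : l.+1%:R^-1 < 1 :> R.
    by rewrite invf_lt1// -natr1 ltrDr.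
  rewrite lnM ?posrE ?divr_gt0// ?subr_gt0//.
  rewrite -addrA gerDl; have : ln (1 + - l.+1%:R^-1) <= - (l.+1%:R^-1 : R).
    by apply: le_ln1Dx; rewrite ltrN2.
  by move=> h; rewrite -lerBrDr sub0r.
have lnl1 : 0 < ln (l.+1%:R / s).
  by apply: lt_le_trans lnl _; apply: le_trans ll; rewrite lerDl invr_ge0.
move: ll; set a := ln (l%:R / s) in lnl *; set c := ln (l.+1%:R / s) in lnl1 *.
move=> ll.
have -> : a^-1 - c^-1 = (c - a) / (a * c) by field; rewrite !gt_eqF.
rewrite invfM; apply: ler_pM; rewrite ?invr_ge0 ?exprn_ge0 ?(ltW l1) ?(ltW lnl1)//.
  by rewrite lerBrDl.
rewrite lef_pV2 ?posrE ?mulr_gt0 ?exprn_gt0//.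
by rewrite expr2 ler_pM2r//; apply: le_trans ll; rewrite lerDl invr_ge0.
Qed.

(** The weight is the size of a sup-norm shell up to a constant. Multiplied by it, the decay of [g]
    still leaves [1 / (l * ln^2 (l / s))], which is summable with a remainder of order
    [1 / ln (k / s)]. *)
Lemma tail_sum_le (k M : nat) : 1 < k%:R / s -> x0 <= k%:R / s ->
  \sum_(i < M) (k + i).+1%:R * g ((k + i).+1%:R / s) <=
  eta * s ^+ 2 / ln (k%:R / s).
Proof.
move=> ks xk.
have mono i : k%:R / s <= (k + i)%:R / s.
  by rewrite ler_pM2r ?invr_gt0// ler_nat leq_addr.
have ln0 i : 0 < ln ((k + i)%:R / s).
  by apply: ln_gt0; exact: lt_le_trans (mono i).
have tele : \sum_(i < M) (k + i).+1%:R * g ((k + i).+1%:R / s) <=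
    eta * s ^+ 2 * ((ln (k%:R / s))^-1 - (ln ((k + M)%:R / s))^-1).
  elim: M => [|M IH]; first by rewrite big_ord0 addn0 subrr mulr0.
  rewrite big_ord_recr /= addnS.
  have := log_term_le (lt_le_trans ks (mono M)) => term.
  have lS : 0 < (k + M).+1%:R :> R by rewrite ltr0n.
  have lnS := ln0 M.+1; rewrite addnS in lnS.
  have : (k + M).+1%:R * g ((k + M).+1%:R / s) <=
      eta * s ^+ 2 * ((k + M).+1%:R * ln ((k + M).+1%:R / s) ^+ 2)^-1.
    have := g_tail (le_trans xk (mono M.+1)); rewrite addnS.
    rewrite -(ler_pM2l lS) => /le_trans; apply.
    rewrite le_eqVlt; apply/orP; left; apply/eqP.
    by move: lnS; set c := ln _ => c0; field; rewrite !gt_eqF.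
  have : eta * s ^+ 2 * ((k + M).+1%:R * ln ((k + M).+1%:R / s) ^+ 2)^-1 <=
     eta * s ^+ 2 * ((ln ((k + M)%:R / s))^-1 - (ln ((k + M).+1%:R / s))^-1).
    by rewrite ler_wpM2l// mulr_ge0// exprn_ge0// ltW.
  move=> h1 h2; apply: le_trans (lerD IH (le_trans h2 h1)) _.
  by rewrite -mulrDr addrA subrK.
apply: le_trans tele _; rewrite ler_wpM2l//.
  by rewrite mulr_ge0// exprn_ge0// ltW.
by rewrite gerBl invr_ge0 ltW.
Qed.

End logarithmic_tail.

(** * Interior, edge and corner cells *)

Section grid_estimate.
Context {R : realType}.
Variables (n k : nat) (g : R -> R) (s C eta x0 : R).
Hypotheses (g_range : forall x : R, 0 <= x -> 0 <= g x <= 1)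
  (g_noninc : forall x y : R, 0 <= x -> x <= y -> g y <= g x)
  (C_def : (\int[(lebesgue_measure \x lebesgue_measure)%E]_x
              (g (enorm x))%:E)%E = C%:E)
  (s_gt0 : 0 < s) (mn : (2 * k.+2 <= n.+1)%N) (eta_ge0 : 0 <= eta)
  (g_tail : forall x, x0 <= x -> g x <= eta / (x ^+ 2 * ln x ^+ 2))
  (ks : 1 < k%:R / s) (xk : x0 <= k%:R / s).
Let N := n.+1.
(** With nearness up to [k + 1], the tail over [l >= m] telescopes from [ln (k / s)]. *)
Let m := k.+1.
Let H := profile g s.
Let h (l : nat) := g (l%:R / s).
Let S := \sum_(i < m) \sum_(j < m) H i.+2 j.+2.
Let tau := eta * s ^+ 2 / ln (k%:R / s).
Implicit Types c : 'I_N * 'I_N.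

Let H_ge0 i j : 0 <= H i j.
Proof. by have /andP[] := g_range (enorm_ge0 (i%:R / s, j%:R / s)). Qed.

Let H_le1 i j : H i j <= 1.
Proof. by have /andP[] := g_range (enorm_ge0 (i%:R / s, j%:R / s)). Qed.

Let h_ge0 l : 0 <= h l.
Proof.
by have /andP[] : 0 <= h l <= 1 by apply: g_range; rewrite divr_ge0 ?(ltW s_gt0).
Qed.

Lemma weighted_tail_le M : \sum_(l < M | (m <= l)%N) l%:R * h l <= tau.
Proof.
rewrite -(big_mkord (fun l => (m <= l)%N) (fun l => l%:R * h l)).
have -> : \sum_(0 <= l < M | (m <= l)%N) l%:R * h l =
    \sum_(m <= l < M) l%:R * h l.
  by rewrite [RHS](big_nat_widenl _ 0).
rewrite -[X in \sum_(X <= _ < _) _]add0n big_addn big_mkord.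
apply: le_trans (tail_sum_le s_gt0 eta_ge0 g_tail (M - m) ks xk).
by rewrite le_eqVlt; apply/orP; left; apply/eqP; apply: eq_bigr => i _;
  rewrite addnC addSn.
Qed.

(** Inside the square of side [m.+2], [S] misses only the first two rows and columns, that is at
    most [4 * m.+2] terms not exceeding 1. Outside, [g] is bounded on sup-norm shells, of size
    [2 * i + 1 <= 3 * i]. *)
Lemma integral_le_near_sum : C * s ^+ 2 <= 4 * (S + (4 * m.+2)%:R + 3 * tau).
Proof.
apply: (@integral_le_riemann _ g s C g_range g_noninc C_def s_gt0 m.+2) => l.
set M := (m.+2 + l)%N.
pose f l := if (m.+2 <= l)%N then h l else 0.
apply: (@le_trans _ _ (\sum_(i < M) \sum_(j < M)
  ((if (i < m.+2)%N then (if (j < m.+2)%N then H i j else 0) else 0) + f (maxn i j)))).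
  apply: ler_sum => i _; apply: ler_sum => j _; rewrite /f.
  case: (ltnP i m.+2) => im.
    case: (ltnP j m.+2) => jm.
      by rewrite lerDl; case: ifP.
    by rewrite add0r ifT ?profile_le_max// leq_max jm orbT.
  by rewrite add0r ifT ?profile_le_max// leq_max im.
under eq_bigr do rewrite big_split; rewrite big_split /=; apply: lerD; last first.
  rewrite square_shells; apply: le_trans (_ : 3 * \sum_(i < M | (m <= i)%N) i%:R * h i <= _).
    rewrite [X in _ <= 3 * X]big_mkcond mulr_sumr; apply: ler_sum => i _; rewrite /f.
    case: ifP => mi; last first.
      by rewrite mulr0 mulr_ge0//; case: ifP => // _; rewrite mulr_ge0.
    rewrite ifT; last by rewrite (leq_trans _ mi)// leqW.
    rewrite mulrA ler_wpM2r// -natrM ler_nat; move: mi; rewrite /m; lia.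
  by rewrite ler_pM2l// weighted_tail_le.
have -> : \sum_(i < M) \sum_(j < M)
    (if (i < m.+2)%N then (if (j < m.+2)%N then H i j else 0) else 0) =
    \sum_(i < m.+2) \sum_(j < m.+2) H i j.
  have mM : (m.+2 <= M)%N by rewrite leq_addr.
  rewrite (big_ord_widen M (fun i => \sum_(j < m.+2) H i j) mM) [RHS]big_mkcond /=.
  apply: eq_bigr => i _; case: ifP => _; last by rewrite big1.
  by rewrite (big_ord_widen M (fun j => H i j) mM) [RHS]big_mkcond.
have split2 (F : nat -> R) : (forall i, F i <= 1) ->
    \sum_(j < m.+2) F j <= 2 + \sum_(j < m) F j.+2.
  move=> F1; rewrite 2!big_ord_recl /= addrA lerD2r.
  by rewrite (_ : 2 = 1 + 1)// lerD.
apply: (@le_trans _ _ (\sum_(i < m.+2) (2 + \sum_(j < m) H i j.+2))).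
  by apply: ler_sum => i _; apply: (split2 (H i)).
rewrite big_split /= sumr_const card_ord 2!big_ord_recl /=.
have row i : \sum_(j < m) H i j.+2 <= m%:R.
  rewrite -[X in _ <= X]mulr1 mulr_natl -[X in _ <= _ *+ X](card_ord m) -sumr_const.
  exact: ler_sum.
have := row 0%N; have := row 1%N; rewrite /S /=.
have -> : (2 : R) *+ m.+2 = 2 * m%:R + 4 by rewrite -mulr_natl -addn2 natrD; ring.
have -> : (4 * m.+2)%:R = 4 * m%:R + 8 :> R by rewrite natrM -addn2 natrD; ring.
rewrite /bump /=; under [X in _ + (_ + (_ + X))]eq_bigr do rewrite !add1n.
have m0 : 0 <= m%:R :> R by [].
move: (\sum_(j < m) H 0%N j.+2) (\sum_(j < m) H 1%N j.+2) (m%:R) m0 => A B q.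
lra.
Qed.

(** The predecessor in [far_prob] pairs [h i] with the shell of index [i + 1], of size
    [2 * i + 3 <= 5 * i]; hence [80 = 16 * 5]. *)
Lemma far_sum_le_tail c : ~~ boundary_cell m c ->
  \sum_c' far_prob m g s c c' <= 80 * tau.
Proof.
move=> nbd; apply: le_trans (far_sum_le g_range s_gt0 mn nbd) _.
rewrite (square_shells (fun l => if (m < l)%N then h l.-1 else 0)).
rewrite big_ord_recl /= mulr0 add0r (_ : 80 = 16 * 5); last by ring.
rewrite -mulrA ler_pM2l//.
apply: le_trans (_ : 5 * \sum_(i < N | (m <= i)%N) i%:R * h i <= _).
  rewrite [X in _ <= 5 * X]big_mkcond mulr_sumr; apply: ler_sum => i _.
  rewrite /bump /= add1n ltnS; case: ifP => mi; last by rewrite !mulr0.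
  rewrite mulrA ler_wpM2r// -natrM ler_nat.
  by case: (nat_of_ord i) mi => // j _; rewrite !mulnS; lia.
by rewrite ler_pM2l// weighted_tail_le.
Qed.

Variables (lam eta0 : R) (d : nat).
Hypotheses (lam_gt0 : 0 < lam) (eta0_ge0 : 0 <= eta0) (dm : (d <= m)%N)
  (H_core : forall i j, (i < d)%N -> (j < d)%N -> eta0 <= H i.+2 j.+2).

(** The gain in expected degree per row of depth: in each of the two quadrants facing the side, a
    row offers at least [d] cells with connection probability at least [eta0]. The gain is counted
    for at most [d] rows, the extent of [H_core]. *)
Let y := 2 * lam * d%:R * eta0.
Let edge p := expR (- (y * (minn p d)%:R)).

Let S_ge0 : 0 <= S.
Proof. by apply: sumr_ge0 => i _; apply: sumr_ge0. Qed.

Lemma near_sum_interior c : ~~ boundary_cell m c ->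
  4 * S <= \sum_c' near_prob m g s c c'.
Proof.
rewrite /boundary_cell negb_or -!leqNgt => /andP[d1 d2].
apply: le_trans _ (near_sum_ge s g_range mn (leqnn m) d1 (leqnn m) d2).
under eq_bigr do rewrite -mulr2n -mulr_natl.
by rewrite -mulr_sumr -/S; lra.
Qed.

Lemma near_sum_corner c : S <= \sum_c' near_prob m g s c c'.
Proof.
apply: le_trans _ (near_sum_ge s g_range mn (leq0n m) (leq0n _) (leq0n m) (leq0n _)).
rewrite big_ord0 addr0; under [X in _ <= X]eq_bigr do rewrite big_ord0 addr0.
by [].
Qed.

Let core_ge p : (p <= m)%N -> d%:R * eta0 * (minn p d)%:R <=
  \sum_(i < p) \sum_(j < m) H i.+2 j.+2.
Proof.
move=> pm; have pd : (minn p d <= p)%N by rewrite geq_minl.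
apply: (@le_trans _ _ (\sum_(i < minn p d) \sum_(j < m) H i.+2 j.+2)); last first.
  rewrite (big_ord_widen p (fun i => \sum_(j < m) H i.+2 j.+2) pd) big_mkcond /=.
  by apply: ler_sum => i _; case: ifP => // _; apply: sumr_ge0.
rewrite mulr_natr -[X in _ *+ X]card_ord -sumr_const; apply: ler_sum => i _.
apply: (@le_trans _ _ (\sum_(j < d) H i.+2 j.+2)); last first.
  rewrite (big_ord_widen m (fun j => H i.+2 j.+2) dm) big_mkcond /=.
  by apply: ler_sum => j _; case: ifP.
rewrite mulr_natl -[X in _ *+ X]card_ord -sumr_const; apply: ler_sum => j _.
by apply: H_core => //; apply: leq_trans (ltn_ord i) _; rewrite geq_minr.
Qed.

(** The two quadrants directed away from the side are complete and give [2 * S]; the two directed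
    towards it keep [depth n c.1] rows, estimated by [core_ge]. *)
Lemma near_sum_edge1 c : (depth n c.1 < m)%N -> (m <= depth n c.2)%N ->
  2 * S + 2 * (d%:R * eta0 * (minn (depth n c.1) d)%:R) <=
  \sum_c' near_prob m g s c c'.
Proof.
move=> /ltnW d1 d2.
apply: le_trans _ (near_sum_ge s g_range mn d1 (leqnn _) (leqnn m) d2).
under eq_bigr do rewrite -mulr2n -mulr_natl.
under [X in _ <= _ + X]eq_bigr do rewrite -mulr2n -mulr_natl.
by rewrite -!mulr_sumr lerD2l ler_pM2l// core_ge.
Qed.

Lemma near_sum_edge2 c : (depth n c.2 < m)%N -> (m <= depth n c.1)%N ->
  2 * S + 2 * (d%:R * eta0 * (minn (depth n c.2) d)%:R) <=
  \sum_c' near_prob m g s c c'.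
Proof.
move=> /ltnW d2 d1.
apply: le_trans _ (near_sum_ge s g_range mn (leqnn m) d1 d2 (leqnn _)).
have := core_ge d2.
have -> : \sum_(i < depth n c.2) \sum_(j < m) H i.+2 j.+2 =
    \sum_(i < m) \sum_(j < depth n c.2) H i.+2 j.+2.
  rewrite exchange_big /=; apply: eq_bigr => i _; apply: eq_bigr => j _.
  exact: profileC.
rewrite big_split /= -/S; lra.
Qed.

(** A depth is attained by at most two rows, whence [(2 * m%:R) ^+ 2] for the corners and, with two
    directions of edges, [4 * N%:R]. Corner cells are counted among the edges as well, which only
    enlarges the bound. *)
Lemma grid_sum_le :
  \sum_(c : 'I_N * 'I_N) lam * expR (- (lam * \sum_c' near_prob m g s c c')) *
     ((boundary_cell m c)%:R + lam * \sum_c' far_prob m g s c c') <=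
  lam * (N%:R ^+ 2 * (expR (- (4 * (lam * S))) * (80 * (lam * tau))) +
    (2 * m%:R) ^+ 2 * expR (- (lam * S)) +
    4 * N%:R * (expR (- (2 * (lam * S))) * \sum_(p < m) edge p)).
Proof.
pose b (a : 'I_N) : R := (depth n a < m)%:R.
have tau_ge0 : 0 <= tau.
  by rewrite divr_ge0 ?mulr_ge0 ?exprn_ge0 ?(ltW s_gt0)// ltW// ln_gt0.
have depth_fib i : (#|[pred a : 'I_N | depth n a == i]| <= 2)%N.
  apply: (@card_le_size _ _ [:: i; (n - i)%N]) => a /eqP.
  by rewrite !inE; apply: depth_fiber; exact: ltn_ord.
have sum_b : \sum_(a : 'I_N) b a <= 2 * m%:R.
  have := sum_comp_le (k := 2) (Q := fun a : 'I_N => (depth n a < m)%N)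
    (f := fun=> 1 : R) (fun _ => ler01) (fun a Qa => Qa) depth_fib.
  rewrite [X in _ <= _ * X -> _]sumr_const card_ord big_mkcond /= => le_b.
  by apply: le_trans le_b; apply: ler_sum => a _; rewrite /b; case: ltnP.
have edge_ge0 p : 0 <= edge p by exact: expR_ge0.
have sum_edge : \sum_(a : 'I_N) b a * edge (depth n a) <= 2 * \sum_(p < m) edge p.
  have := sum_comp_le (k := 2) (Q := fun a : 'I_N => (depth n a < m)%N)
    (f := edge) edge_ge0 (fun a Qa => Qa) depth_fib.
  rewrite big_mkcond /= => le_e; apply: le_trans le_e.
  by apply: ler_sum => a _; rewrite /b; case: ltnP; rewrite ?mul1r ?mul0r.
have b_ge0 a : 0 <= b a by [].
have term c : expR (- (lam * \sum_c' near_prob m g s c c')) *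
     ((boundary_cell m c)%:R + lam * \sum_c' far_prob m g s c c') <=
   expR (- (4 * (lam * S))) * (80 * (lam * tau)) +
   b c.1 * b c.2 * expR (- (lam * S)) +
   expR (- (2 * (lam * S))) * (b c.1 * edge (depth n c.1) + b c.2 * edge (depth n c.2)).
  have [bc|nbd] := boolP (boundary_cell m c); last first.
    rewrite add0r -addrA; apply: ler_wpDr.
      by rewrite addr_ge0 ?mulr_ge0 ?addr_ge0 ?mulr_ge0 ?expR_ge0.
    apply: ler_pM; rewrite ?expR_ge0//.
    - apply: mulr_ge0; first exact: ltW.
      by apply: sumr_ge0 => c' _; rewrite /far_prob; case: ifP => // _; exact: h_ge0.
    - by rewrite ler_expR lerN2 mulrCA ler_pM2l// near_sum_interior.
    - by rewrite mulrCA ler_pM2l// far_sum_le_tail.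
  have -> : \sum_c' far_prob m g s c c' = 0.
    by apply: big1 => c' _; rewrite /far_prob bc andbF.
  rewrite mulr0 addr0 mulr1 -addrA; apply: ler_wpDl.
    by rewrite mulr_ge0 ?expR_ge0// mulr_ge0// mulr_ge0// ltW.
  have edgeE p : expR (- (2 * (lam * S))) * edge p =
      expR (- (lam * (2 * S + 2 * (d%:R * eta0 * (minn p d)%:R)))).
    by rewrite /edge /y -expRD; congr expR; ring.
  rewrite /b; move: bc; rewrite /boundary_cell.
  case: (ltnP (depth n c.1) m) => d1; case: (ltnP (depth n c.2) m) => d2 //= _.
  - rewrite !mul1r; apply: ler_wpDr.
      by rewrite mulr_ge0 ?addr_ge0 ?expR_ge0.
    by rewrite ler_expR lerN2 ler_pM2l// near_sum_corner.
  - rewrite !(mul0r, mulr0, addr0, add0r) mul1r edgeE ler_expR lerN2 ler_pM2l//.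
    exact: near_sum_edge1.
  - rewrite !(mul0r, mulr0, addr0, add0r) mul1r edgeE ler_expR lerN2 ler_pM2l//.
    exact: near_sum_edge2.
under eq_bigr do rewrite -mulrA.
rewrite -mulr_sumr ler_pM2l//; apply: le_trans (ler_sum _ (fun c _ => term c)) _.
rewrite !big_split /=; apply: lerD; first apply: lerD.
- by rewrite sumr_const card_prod card_ord -[leLHS]mulr_natl natrM expr2.
- rewrite -mulr_suml ler_wpM2r ?expR_ge0// sum_pair /=.
  under eq_bigr do rewrite -mulr_sumr.
  by rewrite -mulr_suml expr2; apply: ler_pM => //; exact: sumr_ge0.
- rewrite -mulr_sumr [leRHS]mulrCA ler_wpM2l ?expR_ge0// big_split /= !sum_pair /=.
  under eq_bigr do rewrite sumr_const card_ord -[_ *+ _]mulr_natl.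
  rewrite sumr_const card_ord -mulr_sumr -[_ *+ _]mulr_natl.
  by have := ler_wpM2l (ler0n R N) sum_edge; lra.
Qed.

End grid_estimate.

(** * Asymptotics *)
Section edge_sum.
Context {R : realType}.

(** Up to [d] the sum is geometric, and [1 / (1 - exp (- y)) <= 1 + 1 / y] because [exp y >= 1 + y];
    beyond [d] every term equals the last one. *)
Lemma edge_sum_le (y : R) (d m : nat) : 0 < y ->
  \sum_(p < m) expR (- (y * (minn p d)%:R)) <=
  1 + y^-1 + m%:R * expR (- (y * d%:R)).
Proof.
move=> y0.
apply: (@le_trans _ _ (\sum_(p < m) (expR (- y) ^+ p + expR (- (y * d%:R))))).
  apply: ler_sum => p _; rewrite /minn; case: ifP => _.
    by rewrite -expRM_natr mulNr lerDl expR_ge0.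
  by rewrite lerDr exprn_ge0 ?expR_ge0.
rewrite big_split /= sumr_const card_ord -[_ *+ _]mulr_natl lerD2r.
have q0 := expR_gt0 (- y); have q1 : expR (- y) < 1 by rewrite expR_lt1 oppr_lt0.
have geo : (1 - expR (- y)) * \sum_(p < m) expR (- y) ^+ p <= 1.
  have -> : (1 - expR (- y)) * \sum_(p < m) expR (- y) ^+ p = 1 - expR (- y) ^+ m.
    by rewrite -opprB mulNr -subrX1 opprB.
  by rewrite gerBl exprn_ge0// ltW.
have ey : expR (- y) * (1 + y) <= 1.
  rewrite expRN mulrC ler_pdivrMr ?expR_gt0// mul1r; exact: expR_ge1Dx.
have yi : y * y^-1 = 1 by rewrite mulfV// gt_eqF.
have yi0 : 0 < y^-1 by rewrite invr_gt0.
have key : 1 <= (1 - expR (- y)) * (1 + y^-1).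
  have : expR (- y) * (1 + y) * y^-1 <= 1 * y^-1 by rewrite ler_pM2r.
  rewrite mul1r -mulrA mulrDl mul1r yi; lra.
by rewrite -(ler_pM2l (x := 1 - expR (- y))) ?subr_gt0//; apply: le_trans key.
Qed.

Lemma quarter_bounds (x y : R) : x / 4 - 2 <= y ->
  [/\ - y <= 2 + - (x / 4), - (2 * y) <= 4 + - (x / 2) & - (4 * y) <= - x + 8].
Proof. by move=> ?; split; lra. Qed.

End edge_sum.

(** * An explicit bound at one density *)

Section fixed_density.
Context {R : realType} {d : measure_display} {T : measurableType d}.
Variables (P : probability T R) (b C : R) (g : R -> R) (rho : R).
Variables (pts : T -> seq (R * R)) (conn removed : T -> rel nat).
Hypotheses (g_range : forall x : R, 0 <= x -> 0 <= g x <= 1)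
  (g_noninc : forall x y : R, 0 <= x -> x <= y -> g y <= g x)
  (C_gt0 : 0 < C)
  (C_def : (\int[(lebesgue_measure \x lebesgue_measure)%E]_x
              (g (enorm x))%:E)%E = C%:E)
  (rho_gt0 : 0 < rho)
  (bc : boundary_coupling P g (critical_radius b C rho) rho pts conn removed).
Variables (eta x0 v0 theta : R).
Let L := ln rho + b.
Let r := critical_radius b C rho.
Let E := expR (theta * L).
Let eta0 := g (enorm (v0, v0)).
Hypotheses (eta_ge0 : 0 <= eta)
  (g_tail : forall x, x0 <= x -> g x <= eta / (x ^+ 2 * ln x ^+ 2))
  (v0_gt0 : 0 < v0) (eta0_gt0 : 0 < eta0) (theta_gt0 : 0 < theta)
  (theta_le : theta <= 16^-1)
  (theta_beta : theta <= eta0 * v0 ^+ 2 / (4 * C))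
  (eta_le : 6 * eta <= C * theta) (L_ge1 : 1 <= L)
  (E_ge2 : 2 <= expR (theta * L / 2)) (E_x0 : x0 <= expR (theta * L / 2))
  (E_v0 : v0 <= E)
  (L_large : 16 * expR (b / 2) <= Num.sqrt C * Num.sqrt (ln rho + b)).

(** With these square roots, [r = w / (c * p)]; [p] is the square root of [rho], written as an
    exponential so that it combines with powers of [exp L]. *)
Let w := Num.sqrt L.
Let c := Num.sqrt C.
Let p := expR ((L - b) / 2).

Let L_gt0 : 0 < L. Proof. exact: lt_le_trans L_ge1. Qed.
Let w_gt0 : 0 < w. Proof. by rewrite sqrtr_gt0. Qed.
Let c_gt0 : 0 < c. Proof. by rewrite sqrtr_gt0. Qed.
Let p_gt0 : 0 < p. Proof. exact: expR_gt0. Qed.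
Let wE : w ^+ 2 = L. Proof. by rewrite sqr_sqrtr// ltW. Qed.
Let cE : c ^+ 2 = C. Proof. by rewrite sqr_sqrtr// ltW. Qed.

Let pE : p ^+ 2 = rho.
Proof.
rewrite -expRM_natr divfK ?pnatr_eq0// /L addrK lnK//.
Qed.

Let rE : r = w / (c * p).
Proof.
rewrite /r /critical_radius -/L -wE -cE -pE -exprMn -expr_div_n sqrtr_sqr.
by rewrite ger0_norm// divr_ge0 ?mulr_ge0// ltW.
Qed.

Let r_gt0 : 0 < r. Proof. by rewrite rE divr_gt0// mulr_gt0. Qed.

Let w_ge1 : 1 <= w.
Proof. by rewrite -sqrtr1 ler_wsqrtr. Qed.

Let rL : rho * r ^+ 2 = L / C.
Proof.
by rewrite rE -pE -wE -cE; field; rewrite !gt_eqF.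
Qed.

Let E_ge : 1 + expR (theta * L / 2) <= E.
Proof.
have -> : E = expR (theta * L / 2) ^+ 2 by rewrite -expRM_natr divfK ?pnatr_eq0.
by move: E_ge2; set e := expR _ => e2; rewrite expr2; nra.
Qed.

Let expN_le (x : R) : 0 < x -> expR (- x) <= x^-1.
Proof.
move=> x0'; rewrite expRN lef_pV2 ?posrE ?expR_gt0//.
by apply: le_trans (expR_ge1Dx x); rewrite lerDr.
Qed.

Let expN_le2 (x : R) : 0 < x -> expR (- x) <= 2 / x ^+ 2.
Proof.
move=> x0'; rewrite expRN -[leRHS]invrK lef_pV2 ?posrE ?expR_gt0//; last first.
  by rewrite invr_gt0 divr_gt0// exprn_gt0.
have := expR_ge1Dxn 1 (ltW x0'); rewrite invf_div => /(le_trans _); apply.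
by rewrite lerDr.
Qed.

Let expNL_half : expR (- (L / 2)) = expR (- b / 2) / p.
Proof.
have -> : - (L / 2) = - b / 2 - (L - b) / 2 by field.
by rewrite expRD expRN.
Qed.

Let rho_expNL : rho * expR (- L) = expR (- b).
Proof. by rewrite -pE -expRM_natr -expRD; congr expR; field. Qed.

Let theta_L : 0 < theta * L. Proof. exact: mulr_gt0. Qed.

(** [1 / p] is of order [exp (- L / 2)], which outweighs [E] since [theta <= 1 / 16]. The value 1/4
    lets the near cells fit into half of a row. *)
Let delta_le : r * E <= 4^-1.
Proof.
have L4 : 0 < L / 4 by rewrite divr_gt0.
have Ep : E / p <= expR (b / 2) * (L / 4)^-1.
  rewrite -expRN -expRD; apply: (@le_trans _ _ (expR (b / 2) * expR (- (L / 4)))).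
    rewrite -expRD ler_expR.
    have : theta * L <= 16^-1 * L by rewrite ler_pM2r.
    by have := L_gt0; lra.
  by rewrite ler_pM2l ?expR_gt0// expN_le.
have -> : r * E = w / c * (E / p) by rewrite rE; field; rewrite !gt_eqF.
have wc : 0 < w / c by rewrite divr_gt0.
rewrite -(ler_pM2l wc) in Ep; apply: le_trans Ep _.
have -> : w / c * (expR (b / 2) * (L / 4)^-1) = 4 * expR (b / 2) / (c * w).
  by rewrite -wE; move: (expR _) => e; field; rewrite !gt_eqF.
by rewrite ler_pdivrMr ?mulr_gt0//; move: L_large; rewrite -/c -/L -/w; lra.
Qed.

Let discretization : exists n k dd : nat,
  [/\ [/\ (2 * k.+2 <= n.+1)%N, 1 <= n.+1%:R * r, 4 * rho <= n.+1%:R &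
       k%:R <= n.+1%:R * r * E],
      expR (theta * L / 2) <= k%:R / (n.+1%:R * r),
      (dd <= k.+1)%N, dd.+1%:R <= v0 * (n.+1%:R * r) &
      v0 * (n.+1%:R * r) / 2 <= dd%:R].
Proof.
(* The summand 8 leads to [2 * k.+2 <= n.+1], the second to [1 <= s], the third to [4 <= v0 * s], so
   that rounding [v0 * s] costs at most half of it, and the last controls the discretization
   error. *)
pose M := 8 + r^-1 + 4 / (v0 * r) + 4 * rho.
have vr0 : 0 < v0 * r by exact: mulr_gt0.
have Mr : 0 < r^-1 by rewrite invr_gt0.
have Mv : 0 < 4 / (v0 * r) by rewrite divr_gt0.
pose n := Num.truncn M; have := truncnS_gt M; rewrite -/n; set N : R := n.+1%:R.
rewrite /M => NM.
have large (N' x y : R) : 0 < x -> 0 < y -> 8 + x + y + 4 * rho < N' ->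
    [/\ 8 <= N', x <= N', y <= N' & 4 * rho <= N'].
  by move=> *; have := rho_gt0; split; lra.
have [N8 Nr Nv N4] := large _ _ _ Mr Mv NM.
have s1 : 1 <= N * r by rewrite -ler_pdivrMr// div1r.
have v4 : 4 <= v0 * (N * r) by rewrite mulrCA -ler_pdivrMr.
set s := N * r in s1 v4 *.
have s0 : 0 < s by exact: lt_le_trans s1.
have E0 : 0 < E by exact: expR_gt0.
have sE0 : 0 <= s * E by rewrite mulr_ge0// ltW.
have vs0 : 0 <= v0 * s by rewrite mulr_ge0// ltW.
pose k := Num.truncn (s * E); have /andP[k1 k2] := truncn_itv sE0; rewrite -/k in k1 k2.
pose t := Num.truncn (v0 * s); have /andP[t1 t2] := truncn_itv vs0; rewrite -/t in t1 t2.
have t4 : (3 < t)%N by rewrite -ltnS -(ltr_nat R); apply: le_lt_trans t2.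
have tE : t = t.-1.+1 by rewrite prednK// (leq_trans _ t4).
(* The core is used at indices shifted by two: [i < t.-1] has to give [i.+2 <= t <= v0 * s]. *)
exists n, k, t.-1; rewrite -/N -/s -tE; split => //.
- split => //; rewrite -(ler_nat R) natrM -/N -addn2 natrD.
  have : s * E <= N * 4^-1.
    by rewrite /s -mulrA ler_pM2l//; apply: lt_le_trans N8.
  lra.
- rewrite ler_pdivlMr// mulrC.
  have : s * (1 + expR (theta * L / 2)) <= s * E by rewrite ler_pM2l.
  move: k2; rewrite -natr1 mulrDr mulr1; lra.
- apply: (leq_trans (leq_pred t)); rewrite -ltnS -(ltr_nat R).
  apply: le_lt_trans t1 _; apply: le_lt_trans (lt_trans k2 _).
    by rewrite mulrC ler_pM2l.
  by rewrite ltr_nat.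
- have : t%:R = t.-1%:R + 1 :> R by rewrite natr1 -tE.
  move: t2; rewrite -natr1; lra.
Qed.

(** The first summand comes from the interior and is small only through [eta]. The second, with the
    factor [1 / w], comes from the corners and the edges and vanishes as [L] grows. *)
Lemma fixed_density_bound :
  (P [set w | WE pts conn removed w <> 0%N] <=
   (expR (- b) * expR 8 * (160 * eta / (C * theta)) +
    (2048 * expR 2 / C + 4 * expR 4 * (2 + expR (- b / 2) * c / (v0 * eta0) +
       2 * expR (- b / 2) / (c * theta))) / w)%:E)%E.
Proof.
have [n [k [dd [[small s1 N4 kE] ek dk dv vd]]]] := discretization.
set N : R := n.+1%:R in s1 N4 kE ek dv vd.
have N0 : 0 < N by rewrite ltr0n.
apply: le_trans (grid_WE_bound bc g_range g_noninc r_gt0 rho_gt0 small) _.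
rewrite -/r -/N lee_fin.
set s := N * r in s1 kE ek dv vd *; set lam := rho / N ^+ 2.
have s0 : 0 < s by exact: lt_le_trans s1.
have lam0 : 0 < lam by rewrite divr_gt0// exprn_gt0.
have ks : 1 < k%:R / s by apply: lt_le_trans ek; have := E_ge2; lra.
have xk : x0 <= k%:R / s by exact: le_trans ek.
have core i j : (i < dd)%N -> (j < dd)%N -> eta0 <= profile g s i.+2 j.+2.
  have pos l : 0 <= l%:R / s by rewrite divr_ge0// ltW.
  have le_v0 l : (l < dd)%N -> l.+2%:R / s <= v0.
    move=> ld; rewrite ler_pdivrMr//; apply: le_trans dv; rewrite ler_nat; exact: ld.
  move=> id jd; apply: g_noninc; first exact: enorm_ge0.
  by apply: ler_enorm; rewrite /= !ger0_norm ?(ltW v0_gt0)// le_v0.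
apply: le_trans (grid_sum_le g_range s0 small eta_ge0 g_tail ks xk lam0 dk core) _.
have F1 := integral_le_near_sum g_range g_noninc C_def s0 small eta_ge0 g_tail ks xk.
rewrite -/N; set S := \sum_(i < k.+1) _ in F1 *.
set tau := eta * s ^+ 2 / ln (k%:R / s) in F1 *.
have lams : lam * s ^+ 2 = L / C.
  by rewrite -rL /lam /s; field; rewrite gt_eqF.
(* The decisive cancellation: [lam * s ^+ 2 = L / C], while the logarithm in the denominator of
   [tau] is at least [theta * L / 2]. *)
have ltau : lam * tau <= 2 * eta / (C * theta).
  have lnk : theta * L / 2 <= ln (k%:R / s).
    rewrite -[X in X <= _]expRK ler_ln ?posrE ?expR_gt0//.
    by apply: lt_le_trans ek; exact: expR_gt0.
  have -> : lam * tau = eta * (L / C) / ln (k%:R / s).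
    by rewrite -lams /tau; ring.
  have l0 : 0 < theta * L / 2 by rewrite divr_gt0.
  rewrite ler_pdivrMr; last exact: lt_le_trans lnk.
  have -> : eta * (L / C) = 2 * eta / (C * theta) * (theta * L / 2).
    by field; rewrite !gt_eqF.
  by rewrite ler_wpM2l// divr_ge0 ?mulr_ge0// ltW.
(* The crude bound [k.+3 <= N] suffices, since [4 * rho <= N]. *)
have lcells : lam * (4 * k.+3)%:R <= 1.
  have : (4 * k.+3)%:R <= 4 * N.
    rewrite natrM ler_pM2l// /N ler_nat; apply: leq_trans small.
    by rewrite mul2n -addnn addSnnS leq_addl.
  rewrite -(ler_pM2l lam0) => /le_trans; apply.
  have -> : lam * (4 * N) = 4 * rho / N by rewrite /lam; field; rewrite gt_eqF.
  by rewrite ler_pdivrMr// mul1r.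
(* Of the loss of 2, one unit is the discretization error and the other is the tail, by [eta_le]. *)
have lamS : L / 4 - 2 <= lam * S.
  have : lam * (C * s ^+ 2) = L by rewrite mulrCA lams; field; rewrite gt_eqF.
  have lt3 : 3 * (lam * tau) <= 1.
    apply: (@le_trans _ _ (3 * (2 * eta / (C * theta)))); first by rewrite ler_pM2l.
    rewrite !mulrA ler_pdivrMr ?mulr_gt0// mul1r.
    by apply: le_trans eta_le; lra.
  move: F1; rewrite -(ler_pM2l lam0).
  have -> : lam * (4 * (S + (4 * k.+3)%:R + 3 * tau)) =
    4 * (lam * S + lam * (4 * k.+3)%:R + 3 * (lam * tau)) by ring.
  move: (lam * S) (lam * (4 * k.+3)%:R) (lam * tau) (lam * (C * _)) lcells lt3.
  by move=> A B D F *; lra.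
have [lamS1 lamS2 lamS4] := quarter_bounds lamS.
have mE : k.+1%:R <= 2 * (s * E).
  have : 1 <= s * E.
    by rewrite -[1]mulr1; apply: ler_pM => //; move: E_ge E_ge2; lra.
  by rewrite -natr1; lra.
rewrite 2!mulrDr -addrA; apply: lerD.
  have -> : lam * (N ^+ 2 * (expR (- (4 * (lam * S))) * (80 * (lam * tau)))) =
     rho * expR (- (4 * (lam * S))) * (80 * (lam * tau)).
    by rewrite /lam; field; rewrite gt_eqF.
  have -> : 160 * eta / (C * theta) = 80 * (2 * eta / (C * theta)) by field; rewrite !gt_eqF.
  have tau0 : 0 <= lam * tau.
    apply: mulr_ge0; first exact: ltW.
    apply: divr_ge0; last by apply: ltW; exact: ln_gt0.
    by apply: mulr_ge0 => //; apply: exprn_ge0; exact: ltW.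
  apply: ler_pM.
  - by apply: mulr_ge0; [exact: ltW|exact: expR_ge0].
  - exact: mulr_ge0.
  - by rewrite -rho_expNL -mulrA ler_pM2l// -expRD ler_expR.
  - by rewrite ler_pM2l.
rewrite [leRHS]mulrDl; apply: lerD.
  have -> : lam * ((2 * k.+1%:R) ^+ 2 * expR (- (lam * S))) =
    4 * (lam * k.+1%:R ^+ 2) * expR (- (lam * S)) by ring.
  have lm : lam * k.+1%:R ^+ 2 <= 4 * (L / C) * E ^+ 2.
    rewrite -lams (_ : 4 * _ * _ = lam * (2 * (s * E)) ^+ 2); last by ring.
    by rewrite ler_pM2l// (expr2 k.+1%:R) (expr2 (2 * (s * E))); apply: ler_pM.
  have eS : expR (- (lam * S)) <= expR 2 * expR (- (L / 4)).
    by rewrite -expRD ler_expR.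
  (* [theta <= 1 / 16] leaves [exp (- L / 8)], which still beats the factor [L] of the corner
     count. *)
  have EL : E ^+ 2 * expR (- (L / 4)) <= 128 / L ^+ 2.
    apply: (@le_trans _ _ (expR (- (L / 8)))).
      rewrite -expRM_natr -expRD ler_expR.
      have : theta * L <= 16^-1 * L by rewrite ler_pM2r.
      lra.
    have L8 : 0 < L / 8 by rewrite divr_gt0.
    apply: le_trans (expN_le2 L8) _; rewrite le_eqVlt; apply/orP; left; apply/eqP.
    by field; rewrite gt_eqF.
  apply: (@le_trans _ _ (16 * (L / C) * expR 2 * (E ^+ 2 * expR (- (L / 4))))).
    have -> : 16 * (L / C) * expR 2 * (E ^+ 2 * expR (- (L / 4))) =
      4 * (4 * (L / C) * E ^+ 2) * (expR 2 * expR (- (L / 4))) by ring.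
    apply: ler_pM; rewrite ?expR_ge0// ?ler_pM2l//.
    by apply: mulr_ge0 => //; apply: mulr_ge0; [exact: ltW|exact: exprn_ge0].
  apply: (@le_trans _ _ (16 * (L / C) * expR 2 * (128 / L ^+ 2))).
    rewrite ler_pM2l//; apply: mulr_gt0; last exact: expR_gt0.
    by apply: mulr_gt0 => //; exact: divr_gt0.
  have -> : 16 * (L / C) * expR 2 * (128 / L ^+ 2) = 2048 * expR 2 / C / w ^+ 2.
    by rewrite wE; field; rewrite !gt_eqF.
  have K0 : 0 < 2048 * expR 2 / C.
    apply: divr_gt0; last exact: C_gt0.
    apply: mulr_gt0; last exact: expR_gt0.
    by rewrite ltr0n.
  rewrite (ler_pM2l K0) lef_pV2 ?posrE ?exprn_gt0//.
  by rewrite expr2 ler_peMl// ltW.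
set y := 2 * lam * dd%:R * eta0.
have dd0 : 0 < dd%:R :> R.
  by apply: lt_le_trans vd; rewrite divr_gt0 ?mulr_gt0.
have y0 : 0 < y.
  by apply: mulr_gt0 => //; apply: mulr_gt0 => //; apply: mulr_gt0.
have -> : lam * (4 * N * (expR (- (2 * (lam * S))) * \sum_(q < k.+1) expR (- (y * (minn q dd)%:R)))) =
  4 * expR (- (2 * (lam * S))) * (rho / N * \sum_(q < k.+1) expR (- (y * (minn q dd)%:R))).
  rewrite /lam; move: (expR (- (2 * _))) (\sum_(q < _) _) => A B.
  by field; rewrite gt_eqF.
have rN0 : 0 < rho / N by rewrite divr_gt0.
(* The three terms are the outermost row, the geometric decay near the side, and the remaining
   rows. *)
have sumE : rho / N * \sum_(q < k.+1) expR (- (y * (minn q dd)%:R)) <=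
    1 + (v0 * r * eta0)^-1 + 2 * (rho * r) * expR (- (theta * L)).
  apply: le_trans (_ : rho / N * (1 + y^-1 + k.+1%:R * expR (- (y * dd%:R))) <= _).
    by rewrite ler_pM2l// edge_sum_le.
  rewrite [leLHS]mulrDr [X in X + _]mulrDr mulr1.
  apply: lerD; first apply: lerD.
  - rewrite ler_pdivrMr// mul1r; apply: le_trans N4.
    by rewrite ler_peMl ?ler1n// ltW.
  - rewrite ler_pdivrMr// -ler_pdivrMl ?invr_gt0 ?mulr_gt0// invrK.
    have -> : v0 * r * eta0 * (rho / N) = 2 * lam * (v0 * s / 2) * eta0.
      by rewrite /lam /s; field; rewrite gt_eqF.
    by rewrite /y ler_pM2r// ler_pM2l// mulr_gt0.
  (* From [theta_beta]: half of this exponent cancels the factor [E] in the number of rows, the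
     other half remains as [exp (- (theta * L))]. *)
  - have yd : 2 * (theta * L) <= y * dd%:R.
      apply: (@le_trans _ _ (2 * lam * (v0 * s / 2) * eta0 * (v0 * s / 2))).
        have -> : 2 * lam * (v0 * s / 2) * eta0 * (v0 * s / 2) =
          2 * (eta0 * v0 ^+ 2 / (4 * C)) * L.
          have -> : 2 * lam * (v0 * s / 2) * eta0 * (v0 * s / 2) =
             2^-1 * eta0 * v0 ^+ 2 * (lam * s ^+ 2) by field.
          by rewrite lams; field; rewrite gt_eqF.
        by rewrite mulrA ler_pM2r// ler_pM2l.
      have vs0 : 0 <= v0 * s / 2 by rewrite divr_ge0// mulr_ge0// ltW.
      apply: ler_pM => //.
        apply: mulr_ge0; last exact: ltW.
        by apply: mulr_ge0 => //; apply: mulr_ge0 => //; exact: ltW.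
      by rewrite ler_pM2r// ler_pM2l// mulr_gt0.
    have eyd : expR (- (y * dd%:R)) <= expR (- (theta * L)) / E.
      rewrite -expRN -expRD ler_expR -opprD lerN2.
      by apply: le_trans yd; rewrite mulr_natl mulr2n.
    apply: (@le_trans _ _ (rho / N * (2 * (s * E) * (expR (- (theta * L)) / E)))).
      by rewrite ler_pM2l// ler_pM ?expR_ge0.
    rewrite le_eqVlt; apply/orP; left; apply/eqP.
    have E0 : E != 0 by rewrite gt_eqF ?expR_gt0.
    by move: (expR (- (theta * L))) => e; rewrite /s; field; rewrite E0 gt_eqF.
have eS : expR (- (2 * (lam * S))) <= expR 4 * (expR (- b / 2) / p).
  by rewrite -expNL_half -expRD ler_expR.
apply: (@le_trans _ _ (4 * (expR 4 * (expR (- b / 2) / p)) *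
   (1 + (v0 * r * eta0)^-1 + 2 * (rho * r) * expR (- (theta * L))))).
  apply: ler_pM.
  - by rewrite mulr_ge0 ?expR_ge0.
  - by rewrite mulr_ge0 ?(ltW rN0)//; apply: sumr_ge0 => q _; exact: expR_ge0.
  - by rewrite ler_pM2l.
  - exact: sumE.
(* Here [1 / (p * r) = c / w] turns the geometric part into the order [L^(-1/2)]. *)
have -> : 4 * (expR 4 * (expR (- b / 2) / p)) *
   (1 + (v0 * r * eta0)^-1 + 2 * (rho * r) * expR (- (theta * L))) =
   4 * expR 4 * (expR (- b / 2) / p + expR (- b / 2) * c / (v0 * eta0) / w +
      2 * expR (- b / 2) * (w / c) * expR (- (theta * L))).
  rewrite rE -pE; move: (expR (- (theta * L))) (expR (- b / 2)) (expR 4) => e1 e2 e3.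
  by field; rewrite !gt_eqF.
have e4 : 0 < 4 * expR 4 :> R by rewrite mulr_gt0 ?expR_gt0.
rewrite -[leRHS]mulrA (ler_pM2l e4) [leRHS]mulrDl [X in _ <= X + _]mulrDl.
apply: lerD; first apply: lerD => //.
- have L2 : 0 < L / 2 by rewrite divr_gt0.
  rewrite -expNL_half; apply: le_trans (expN_le L2) _.
  by rewrite invf_div ler_pM2l// lef_pV2 ?posrE// -wE expr2 ler_peMl// ltW.
- apply: (@le_trans _ _ (2 * expR (- b / 2) * (w / c) * (theta * L)^-1)).
    by rewrite ler_pM2l ?expN_le// !mulr_gt0 ?expR_gt0 ?invr_gt0.
  rewrite -wE le_eqVlt; apply/orP; left; apply/eqP.
  by move: (expR _) => e; field; rewrite !gt_eqF.
Qed.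

End fixed_density.

(** * Positivity of [g] near the origin *)

Section core.
Context {R : realType}.
Variables (g : R -> R) (C : R).
Hypotheses (g_range : forall x : R, 0 <= x -> 0 <= g x <= 1)
  (g_noninc : forall x y : R, 0 <= x -> x <= y -> g y <= g x)
  (C_gt0 : 0 < C)
  (C_def : (\int[(lebesgue_measure \x lebesgue_measure)%E]_x
              (g (enorm x))%:E)%E = C%:E).

(** Otherwise [g] vanishes on positive arguments and the Riemann sums reduce to the single term at
    the origin, at most 1. The scale [s ^+ 2 = 8 / C] then gives [8 <= 4]. *)
Lemma positive_core : exists2 v : R, 0 < v & 0 < g (enorm (v, v)).
Proof.
apply: contrapT => no_core.
have g0 x : 0 < x -> g x = 0.
  move=> x0; have /andP[gx0 _] := g_range (ltW x0).
  apply/eqP; rewrite eq_le gx0 andbT leNgt; apply/negP => gx.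
  apply: no_core; exists (x / 2); first by rewrite divr_gt0.
  apply: lt_le_trans gx _; apply: g_noninc; first exact: enorm_ge0.
  rewrite /enorm /= -[leRHS]gtr0_norm// -sqrtr_sqr; apply: ler_wsqrtr.
  by rewrite !expr2; nra.
pose s := Num.sqrt (8 / C).
have s0 : 0 < s by rewrite sqrtr_gt0 divr_gt0.
have : C * s ^+ 2 <= 4 * 1.
  apply: (integral_le_riemann g_range g_noninc C_def s0 (M0 := 1)) => k.
  have prof i j : (0 < maxn i j)%N -> profile g s i j = 0.
    move=> ij; apply: g0; have [i0|j0] : (0 < i)%N \/ (0 < j)%N.
      by move: ij; rewrite leq_max => /orP.
      apply: lt_le_trans (le_enorm1 _); rewrite /= normr_gt0.
      by rewrite mulf_neq0// ?invr_eq0 ?gt_eqF// ltr0n.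
    apply: lt_le_trans (le_enorm2 _); rewrite /= normr_gt0.
    by rewrite mulf_neq0// ?invr_eq0 ?gt_eqF// ltr0n.
  rewrite add1n big_ord_recl big_ord_recl /= !big1 ?addr0.
  - by have /andP[] := g_range (enorm_ge0 (0%:R / s, 0%:R / s)).
  - by move=> i _; apply: big1 => j _; apply: prof; rewrite leq_max.
  - by move=> j _; apply: prof; rewrite leq_max orbT.
rewrite sqr_sqrtr ?divr_ge0 ?(ltW C_gt0)// mulrCA mulfV ?gt_eqF//; lra.
Qed.

End core.

Lemma le_sum_bound {R : realType} (x y z : R) :
  `|x| + `|y| + 1 <= z -> x <= z /\ y <= z.
Proof.
have := ler_norm x; have := ler_norm y.
by have := normr_ge0 x; have := normr_ge0 y; lra.
Qed.

(** * Choice of the constants and passage to the limit *)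

Unset Implicit Arguments.

Theorem theorem3 (R : realType) (b C : R) (g : R -> R)
  (g_range : forall x : R, 0 <= x -> 0 <= g x <= 1)
  (g_noninc : forall x y : R, 0 <= x -> x <= y -> g y <= g x)
  (C_gt0 : 0 < C)
  (C_def : (\int[(lebesgue_measure \x lebesgue_measure)%E]_x
              (g (enorm x))%:E)%E = C%:E)
  (g_tail : forall eps : R, 0 < eps ->
     \forall x \near +oo, `|g x| <= eps * `|(x ^+ 2 * ln x ^+ 2)^-1|)
  (d : R -> measure_display) (T : forall rho : R, measurableType (d rho))
  (P : forall rho : R, probability (T rho) R)
  (pts : forall rho : R, T rho -> seq (R * R))
  (conn removed : forall rho : R, T rho -> rel nat)
  (coupling : forall rho : R, 0 < rho -> 0 < ln rho + b ->
     boundary_coupling (P rho) g (critical_radius b C rho) rho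
       (pts rho) (conn rho) (removed rho)) :
  (P rho [set w | WE (pts rho) (conn rho) (removed rho) w = 0%N])
    @[rho --> +oo] --> 1%:E.
Proof.
have [v0 v0_gt0 core] := positive_core g_range g_noninc C_gt0 C_def.
set eta0 := g _ in core.
pose beta := eta0 * v0 ^+ 2 / (4 * C).
have beta0 : 0 < beta by rewrite divr_gt0 ?mulr_gt0 ?exprn_gt0.
pose theta := Num.min 16^-1 beta.
have theta0 : 0 < theta by rewrite lt_min beta0 invr_gt0 ltr0n.
have large e : 0 < e -> exists2 L0 : R, 1 <= L0 & forall rho, 0 < rho ->
    L0 <= ln rho + b ->
    (P rho [set w | WE (pts rho) (conn rho) (removed rho) w <> 0%N] <= e%:E)%E.
  move=> e0.
  pose A := expR (- b) * expR 8 * (160 / (C * theta)).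
  have A0 : 0 < A.
    apply: mulr_gt0; first by apply: mulr_gt0; exact: expR_gt0.
    by apply: divr_gt0; [rewrite ltr0n|exact: mulr_gt0].
  (* The first bound is [eta_le]; the second makes the interior term [eta * A] at most [e / 2]. *)
  pose eta := Num.min (C * theta / 6) (e / (2 * A)).
  have eta_gt0 : 0 < eta.
    by rewrite lt_min; apply/andP; split; apply: divr_gt0 => //; exact: mulr_gt0.
  have [M [_ tailM]] := g_tail eta eta_gt0.
  pose x0 := `|M| + 1.
  have tail x : x0 <= x -> g x <= eta / (x ^+ 2 * ln x ^+ 2).
    move=> xx; apply: le_trans (ler_norm _) _; apply: le_trans (tailM x _) _.
      by apply: lt_le_trans xx; rewrite /x0; have := ler_norm M; lra.
    by rewrite ger0_norm// invr_ge0 mulr_ge0 ?sqr_ge0.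
  pose K := 2048 * expR 2 / C + 4 * expR 4 * (2 +
    expR (- b / 2) * Num.sqrt C / (v0 * eta0) +
    2 * expR (- b / 2) / (Num.sqrt C * theta)).
  pose c := Num.sqrt C; have c0 : 0 < c by rewrite sqrtr_gt0.
  (* A lower bound for [Num.sqrt L]: the first summand makes the boundary term at most [e / 2], the
     second yields [L_large]. *)
  pose W := `|2 * K / e| + `|16 * expR (b / 2) / c| + 1.
  have W1 : 1 <= W by rewrite lerDr addr_ge0.
  have W2 : 1 <= W ^+ 2 by rewrite expr_ge1// (le_trans _ W1).
  (* A lower bound for [exp (theta * L / 2)]; the summand [v0 + 2] serves both [E_ge2] and
     [E_v0]. *)
  pose Y := `|x0| + `|v0 + 2| + 1.
  have Y0 : 0 < Y by rewrite ltr_wpDl// addr_ge0.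
  have Ypos : 0 < 2 * Y / theta by apply: divr_gt0 => //; exact: mulr_gt0.
  exists (W ^+ 2 + 2 * Y / theta).
    by apply: le_trans W2 _; rewrite lerDl ltW.
  move=> rho rho0 Lrho; set L := ln rho + b in Lrho.
  have LW : W ^+ 2 <= L by apply: le_trans Lrho; rewrite lerDl ltW.
  have L1 : 1 <= L by exact: le_trans LW.
  have wW : W <= Num.sqrt L.
    by rewrite -[W]ger0_norm ?(le_trans _ W1)// -sqrtr_sqr ler_wsqrtr.
  have w0 : 0 < Num.sqrt L by rewrite (lt_le_trans _ wW)// (lt_le_trans _ W1).
  have [KW bW] := le_sum_bound wW.
  have eY : Y <= expR (theta * L / 2).
    apply: (@le_trans _ _ (theta * L / 2)); last first.
      by apply: le_trans (expR_ge1Dx _); rewrite lerDr.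
    have : 2 * Y / theta <= L.
      by apply: le_trans Lrho; rewrite lerDr (le_trans _ W2).
    by rewrite ler_pdivrMr// => h; rewrite ler_pdivlMr// [Y * _]mulrC [theta * _]mulrC.
  have [x0e v0e] := le_sum_bound eY.
  have eE : expR (theta * L / 2) <= expR (theta * L).
    by rewrite ler_expR ler_pdivrMr// ler_peMr ?ler1n// mulr_ge0 ?ltW// (lt_le_trans _ L1).
  have bound := @fixed_density_bound R _ _ (P rho) b C g rho (pts rho) (conn rho)
    (removed rho) g_range g_noninc C_gt0 C_def rho0
    (coupling rho rho0 (lt_le_trans ltr01 L1)) eta x0 v0 theta (ltW eta_gt0) tail
    v0_gt0 core theta0.
  apply: le_trans (bound _ _ _ L1 _ x0e _ _) _.
  - by rewrite ge_min lexx.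
  - by rewrite ge_min lexx orbT.
  - by rewrite mulrC -ler_pdivlMr// ge_min lexx.
  - by apply: le_trans v0e; rewrite lerDr ltW.
  - by apply: le_trans eE; apply: le_trans v0e; rewrite lerDl.
  - by rewrite [leRHS]mulrC -ler_pdivrMr.
  rewrite lee_fin -/L -/K (splitr e); apply: lerD.
    have -> : expR (- b) * expR 8 * (160 * eta / (C * theta)) = eta * A.
      by rewrite /A [160 * eta]mulrC -[eta * 160 / _]mulrA mulrCA.
    have : eta <= e / (2 * A) by rewrite ge_min lexx orbT.
    rewrite -(ler_pM2r A0) => /le_trans; apply.
    by rewrite invfM -mulrA divfK// gt_eqF.
  by rewrite ler_pdivrMr// -ler_pdivrMl ?divr_gt0// invf_div mulrAC.
(* The coupling, and with it measurability, is given only where [0 < ln rho + b]; the limit is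
   therefore handled through eventual statements. *)
have meas rho : 0 < rho -> 0 < ln rho + b ->
    measurable [set w | WE (pts rho) (conn rho) (removed rho) w <> 0%N].
  by move=> rho0 L0; exact: measurable_WE_neq0 (coupling rho rho0 L0).
have near_L (L0 : R) : \forall rho \near +oo, 0 < rho /\ L0 <= ln rho + b.
  exists (expR (L0 - b)); split; first exact: num_real.
  move=> rho rho_gt; have rho0 : 0 < rho by exact: lt_trans (expR_gt0 _) rho_gt.
  by split=> //; rewrite -lerBlDr -[leLHS]expRK ler_ln ?posrE ?expR_gt0// ltW.
have compl rho : 0 < rho -> 0 < ln rho + b ->
    (P rho [set w | WE (pts rho) (conn rho) (removed rho) w = 0%N] =
     1 - P rho [set w | WE (pts rho) (conn rho) (removed rho) w <> 0%N])%E.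
  move=> rho0 L0; rewrite -(probability_setC _ (meas rho rho0 L0)); congr (P rho _).
  by apply/seteqP; split => w /=; [move=> -> []|move=> ?; apply: contrapT].
apply/fine_cvgP; split.
  near=> rho; have [rho0 L1] : 0 < rho /\ 1 <= ln rho + b by near: rho; exact: near_L.
  have L0 := lt_le_trans ltr01 L1.
  rewrite fin_num_measure// (_ : [set w | _] =
    ~` [set w | WE (pts rho) (conn rho) (removed rho) w <> 0%N]).
    exact: measurableC (meas rho rho0 L0).
  by apply/seteqP; split => w /=; [move=> -> []|move=> ?; apply: contrapT].
apply/cvgrPdist_le => e e0.
have [L0 L01 bound] := large e e0.
near=> rho; have [rho0 LL] : 0 < rho /\ L0 <= ln rho + b by near: rho; exact: near_L.
have Lpos : 0 < ln rho + b by apply: lt_le_trans LL; exact: lt_le_trans L01.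
have := bound rho rho0 LL; rewrite /= compl//.
have : (0 <= P rho [set w | WE (pts rho) (conn rho) (removed rho) w <> 0%N])%E.
  exact: measure_ge0.
have : P rho [set w | WE (pts rho) (conn rho) (removed rho) w <> 0%N] \is a fin_num.
  by rewrite fin_num_measure//; exact: meas.
case: (P rho _) => // q _; rewrite !lee_fin => q0 qe.
by rewrite -EFinB /= subKr ger0_norm.
Unshelve. all: end_near. Qed.
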